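(* Let $\{X_i\}_{i=1,\dots,n}$ be an $m$-dependent sequence of identically distributed random variables with probability density (or mass) function $f(x_i|x_{i-1},\ldots,x_{i-m};\theta)$, where $\theta\in\Theta$ and $(x_1,\ldots,x_n)\in S$, with $S$ the support of the joint probability density (or mass) function. Let $\theta_0$ be the true parameter value, let $l(\theta;\boldsymbol{x})$ be the log-likelihood, with $\theta$-derivatives $l',l'',l^{(3)}$, and assume that the maximum likelihood estimator $\hat\theta_n(\boldsymbol{X})$ exists and is unique. Assume that: (A.D.1) $l(\theta;\boldsymbol{x})$ is three times differentiable in $\theta$ with third derivative uniformly bounded in $\theta\in\Theta$, $\boldsymbol{x}=(x_1,\ldots,x_n)\in S$, the supremum being denoted by $S_d(n):=\sup_{\theta\in\Theta,\ \boldsymbol{x}\in S}|l^{(3)}(\theta;\boldsymbol{x})|<\infty$; (A.D.2) $\mathrm{E}\left[\frac{\mathrm{d}}{\mathrm{d}\theta}\log f(X_1|\theta)\big|_{\theta=\theta_0}\right]=0$ and $\mathrm{E}\left[\frac{\mathrm{d}}{\mathrm{d}\theta}\log f(X_i|X_{i-1},\ldots,X_{i-m};\theta)\big|_{\theta=\theta_0}\right]=0$ for $i=2,3,\ldots,n$; (A.D.3) $\sqrt{n}\,\mathrm{E}[\hat\theta_n(\boldsymbol{X})-\theta_0]\to 0$ as $n\to\infty$; (A.D.4) the limit $i_2(\theta_0):=\lim_{n\to\infty}\frac{1}{n\,\mathrm{Var}(\hat\theta_n(\boldsymbol{X}))}$ exists and $i_2(\theta_0)>0$. Assume moreover that $\mathrm{Var}[l'(\theta_0;\boldsymbol{X})]>0$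 and that $$\alpha:=\alpha(\theta_0,n):=\sqrt{\frac{\mathrm{Var}(l'(\theta_0;\boldsymbol{X}))}{\mathrm{Var}(\hat\theta_n(\boldsymbol{X}))}}$$ is finite and not equal to zero. Let $$\xi_1=\frac{\mathrm{d}}{\mathrm{d}\theta}\log f(X_1|\theta)\Big|_{\theta=\theta_0}\sqrt{\frac{n}{\mathrm{Var}(l'(\theta_0;\boldsymbol{X}))}},\qquad \xi_i=\frac{\mathrm{d}}{\mathrm{d}\theta}\log f(X_i|X_{i-1},\ldots,X_{i-m};\theta)\Big|_{\theta=\theta_0}\sqrt{\frac{n}{\mathrm{Var}(l'(\theta_0;\boldsymbol{X}))}}\quad (i=2,\ldots,n),$$ and, for $j\in\{1,\ldots,n\}$, let $$A_j=\{\max\{1,j-2m\},\ldots,\min\{n,j+2m\}\},\qquad B_j=\{\max\{1,j-4m\},\ldots,\min\{n,j+4m\}\},$$ with $|A_j|$ the number of elements of $A_j$. Then, for $Z\sim \mathrm{N}(0,1)$, $$\begin{aligned} d_W\left(\sqrt{n\,i_2(\theta_0)}\,(\hat\theta_n(\boldsymbol{X})-\theta_0),Z\right)\le{}& \frac{2}{n^{3/2}}\sum_{i=1}^n\sum_{j\in A_i}\sum_{k\in B_i}\left[\mathrm{E}(\xi_i^4)\,\mathrm{E}(\xi_j^4)\,\mathrm{E}(\xi_k^4)\right]^{1/4}\\ &+\frac{2}{n^{3/2}}\sum_{i=1}^n\sum_{j\in A_i}\sum_{k\in B_i}\left[\mathrm{E}(\xi_i^2)\,\mathrm{E}(\xi_j^2)\,\mathrm{E}(\xi_k^2)\right]^{1/2}\\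 &+\frac{1}{n^{3/2}}\sum_{i=1}^n|A_i|\sum_{j\in A_i}\left[\mathrm{E}(\xi_i^2)\,\mathrm{E}(\xi_j^4)\right]^{1/2}\\ &+\left|\frac{\sqrt{n\,i_2(\theta_0)\,\mathrm{Var}[l'(\theta_0;\boldsymbol{X})]}}{\alpha}-1\right|+\frac{S_d(n)\sqrt{n\,i_2(\theta_0)}}{2\alpha}\,\mathrm{E}\left[(\hat\theta_n(\boldsymbol{X})-\theta_0)^2\right]\\ &+\frac{\sqrt{n\,i_2(\theta_0)}}{\alpha}\sqrt{\mathrm{E}\left[(\hat\theta_n(\boldsymbol{X})-\theta_0)^2\right]}\sqrt{\mathrm{E}\left[(l''(\theta_0;\boldsymbol{X})+\alpha)^2\right]}. \end{aligned}$$
   Context: A sequence $\{X_i\}_{i\in\mathbb{N}}$ is $m$-dependent if for each $i$ the sets of random variables $\{X_j: j\le i\}$ and $\{X_j: j>i+m\}$ are independent. The model has a scalar unknown parameter $\theta$ in the parameter space $\Theta\subset\mathbb{R}$; $\theta_0$ is its true value, and all expectations, variances and distributions are taken under $\theta_0$. Write $\boldsymbol{X}=(X_1,\ldots,X_n)$. The joint density (or mass) function of $X_1,\dots,X_n$ under parameter $\theta$ is $$f(\boldsymbol{x}|\theta)=f(x_1;\theta)\prod_{i=2}^n f(x_i|x_{i-1},\ldots,x_{m_i^*};\theta),\qquad m_i^*=\max\{i-m,1\},$$ where $f(x_i|\cdot;\theta)$ are the conditional densities. The notation $f(x_i|x_{i-1},\ldots,x_{i-m};\theta)$ means $f(x_i|x_{i-1},\ldots,x_{m_i^*};\theta)$,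 so that only variables with index at least $1$ appear in the conditioning, and $f(x_1|\theta)=f(x_1;\theta)$. The likelihood is $L(\theta;\boldsymbol{x})=f(\boldsymbol{x}|\theta)$, the log-likelihood is $l(\theta;\boldsymbol{x})=\log L(\theta;\boldsymbol{x})$, and $l',l'',l^{(3)}$ denote its first three derivatives in $\theta$. The maximum likelihood estimator $\hat\theta_n(\boldsymbol{x})$ is the maximizer of $\theta\mapsto L(\theta;\boldsymbol{x})$ over $\Theta$. In the limits in (A.D.3) and (A.D.4) the sample size $n$ varies. For real random variables $F,G$, the Wasserstein distance between their laws is $d_W(F,G)=\sup\{|\mathrm{E}[h(F)]-\mathrm{E}[h(G)]| : h\in H_W\}$, where $H_W=\{h:\mathbb{R}\to\mathbb{R} : |h(x)-h(y)|\le|x-y| \text{ for all } x,y\}$.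
   Formalization: The parameter space Θ is taken to be an open interval; for an arbitrary subset of the reals (for example a disconnected one) the likelihood equation and Taylor expansion between θ_0 and the maximum likelihood estimator break down and the bound can fail. *)

(* Defs.v *)
From HB Require Import structures.
From mathcomp Require Export all_boot all_order all_algebra.
From mathcomp Require Export all_classical all_reals all_analysis.
Export Order.TTheory GRing.Theory Num.Theory.
Export numFieldNormedType.Exports.

#[global] Set Implicit Arguments.
#[global] Unset Strict Implicit.
#[global] Unset Printing Implicit Defensive.

Local Open Scope classical_set_scope.
Local Open Scope ring_scope.

(* Indices of observations start at 1: the random variables are X 1, X 2, ...
   (X 0 is never used), and the coordinate x_j of a vector x is x`_j.-1. *)

Section Dependence.
Context {d : measure_display} {Omega : measurableType d} {R : realType}.
Variables (P : probability Omega R) (X : nat -> {RV P >-> R}).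

Definition sigma_of (J : set nat) : set (set Omega) :=
  <<s \bigcup_(j in J) preimage_set_system setT (X j) measurable >>.

Definition m_dependent (m : nat) : Prop :=
  forall i, (1 <= i)%N -> forall A B : set Omega,
    sigma_of [set j | (1 <= j <= i)%N] A ->
    sigma_of [set j | (i + m < j)%N] B ->
    P (A `&` B) = (P A * P B)%E.

Definition identically_distributed : Prop :=
  forall i, (1 <= i)%N -> distribution P (X i) = distribution P (X 1%N).

Definition sample (n : nat) (w : Omega) : n.-tuple R :=
  [tuple X i.+1 w | i < n].

End Dependence.

Section Wasserstein.
Context {d1 d2 : measure_display} {T1 : measurableType d1}
  {T2 : measurableType d2} {R : realType}.
Variables (P1 : probability T1 R) (P2 : probability T2 R).

Definition wasserstein (F : T1 -> R) (G : T2 -> R) : \bar R :=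
  ereal_sup [set `| 'E_P1[h \o F] - 'E_P2[h \o G] |%E
            | h in [set h : R -> R | forall x y, `|h x - h y| <= `|x - y|]].

End Wasserstein.

Section Likelihood.
Context {R : realType}.
(* f i s y theta is the conditional density f(y | s; theta) of X_i at y given
   s = (x_{i-1}, ..., x_{m_i^*}), where m_i^* = max {i - m, 1}. For i = 1, s is
   empty and f is the density of X_1. The sequence need not be strictly
   stationary, so f may depend on i. *)
Variables (m : nat) (f : nat -> seq R -> R -> R -> R).

Definition past (x : seq R) (i : nat) : seq R :=
  [seq x`_j.-1 | j <- rev (index_iota (maxn (i - m) 1) i)].

Definition cond_dens (i : nat) (x : seq R) (theta : R) : R :=
  f i (past x i) x`_i.-1 theta.

Definition lik (n : nat) (x : n.-tuple R) (theta : R) : R :=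
  \prod_(1 <= i < n.+1) cond_dens i x theta.

Definition loglik (n : nat) (x : n.-tuple R) (theta : R) : R :=
  ln (lik x theta).

Definition log_cond_dens (i : nat) (x : seq R) (theta : R) : R :=
  ln (cond_dens i x theta).

Definition argmax_lik (Theta : set R) (n : nat) (x : n.-tuple R) : set R :=
  [set t | Theta t /\ forall t', Theta t' -> lik x t' <= lik x t].

(* S n is the support of the joint density of n observations, in the sense of
   the set where it is positive; it is the same for all theta. *)
Definition common_support (Theta : set R) (S : forall n, set (n.-tuple R)) :=
  forall n theta, Theta theta -> S n = [set x : n.-tuple R | 0 < lik x theta].

Definition sup_third (Theta : set R) (n : nat) (S : set (n.-tuple R)) :
    \bar R :=
  ereal_sup [set (`| derive1n 3 (loglik p.2) p.1 |)%:E | p in Theta `*` S].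

Definition three_times_derivable (Theta : set R) (n : nat)
    (S : set (n.-tuple R)) : Prop :=
  forall theta x k, Theta theta -> S x -> (k < 3)%N ->
    derivable (derive1n k (loglik x)) theta 1.

(* nu stands for the Lebesgue measure (probability density functions) or the
   counting measure (probability mass functions). *)
Variable nu : {measure set (measurableTypeR R) -> \bar R}.

(* f i depends on y and on min(m, i - 1) past values. Values of f given a past
   outside the support are irrelevant. *)
Definition conditional_densities (Theta : set R)
    (S : forall n, set (n.-tuple R)) : Prop :=
  forall theta, Theta theta ->
  [/\ forall i s y, (1 <= i)%N -> 0 <= f i s y theta,
      forall i, (1 <= i)%N ->
        measurable_fun [set: (minn m i.-1).+1.-tuple R]
          (fun z : (minn m i.-1).+1.-tuple R =>
             f i (behead z) (thead z) theta) &
      forall i (x : i.-tuple R), S i x ->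
        (\int[nu]_y (f i.+1 (past x i.+1) y theta)%:E = 1)%E].

(* Integral over R^n with respect to the n-fold product of nu *)
Fixpoint iterated_integral (n : nat) : (n.-tuple R -> \bar R) -> \bar R :=
  match n with
  | 0 => fun F => F [tuple]
  | k.+1 => fun F =>
      (\int[nu]_y iterated_integral (fun t : k.-tuple R => F [tuple of y :: t]))%E
  end.

Definition has_joint_density {d : measure_display} {Omega : measurableType d}
    (P : probability Omega R) (n : nat) (Y : Omega -> n.-tuple R)
    (g : n.-tuple R -> R) : Prop :=
  forall B : set (n.-tuple R), measurable B ->
    P (Y @^-1` B) = iterated_integral (fun x => (\1_B x * g x)%:E).

End Likelihood.

Definition nbhd (r n j : nat) : seq nat :=
  index_iota (maxn 1 (j - r)) (minn n (j + r)).+1.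

Definition setA (m n j : nat) : seq nat := nbhd (2 * m) n j.
Definition setB (m n j : nat) : seq nat := nbhd (4 * m) n j.

(* Main.v *)
(* On the likelihood support, the likelihood equation [l'(thetahat) = 0] and a
   second-order Taylor expansion of the score at [theta0] give, with
   [D = thetahat - theta0] and [c = sqrt (n i2)],
     [c D = (c / alpha) l' + (c / alpha) (D (l'' + alpha) + r)]
   where [|r| <= Sd / 2 * D ^ 2].  Against a 1-Lipschitz [h], the last two
   terms of the bound control the remainder (Cauchy-Schwarz), and the fourth
   one the replacement of [(c / alpha) l'] by the normalised score
   [W = l' / sqrt (Var l')].

   [W] is a sum of locally dependent variables [zeta_i = xi_i / sqrt n], and
   Stein's method applies: the solution [F] of [F' - x F = h - E h(Z)] is
   bounded by 1 and [F'] is 2-Lipschitz, so expanding [F (W)] around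
   [W - \sum_(j in A_i) zeta_j] and [F' (W)] around [W - \sum_(k in B_i) zeta_k]
   leaves mixed third absolute moments, bounded by the Cauchy-Schwarz inequality.

   The scores are derivatives of measurable functions defined on the support
   only; each agrees there with a version measurable with respect to a block of
   the [X_j], obtained as an upper limit of difference quotients.  If some
   fourth moment of a score is infinite, so is the right-hand side. *)
Require Import Defs.
From mathcomp Require Import ring lra zify.
From mathcomp Require Import measurable_realfun.

Local Open Scope classical_set_scope.
Local Open Scope ring_scope.

(** * Real analysis and the standard normal density *)

Section RealLemmas.
Context {R : realType}.

(** The test functions are only Lipschitz, so [F] need not be twice differentiable. A Lipschitz
    bound on [F' = x F + g], with [g = h - E h(Z)], takes the place of a bound on [F'']: [g]
    contributes 1, and [x F] contributes 1 because its derivative lies between -1 and 1. The latter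
    rests on the Gaussian tail inequality [1 - Phi x >= x p(x) / (1 + x^2)] and its mirror image.

    The radii [2m] and [4m] come from windows. The score of index [i] is a function of
    [X_(i-m), ..., X_i], so the windows of two scores are more than [m] apart once their indices
    differ by more than [2m]. A product of the scores [i] and [j] with [j] in [A_i] occupies
    [X_(i-3m), ..., X_(i+2m)]; on the right, [m] for the gap and [m] for the next window lead to
    [4m]. As m-dependence only separates a past from a future, independence of a middle block from
    both of its sides jointly takes two applications.

    Integrability is settled uniformly: finite fourth moments give one envelope [S] with [S^4]
    integrable, and the integrands of the Stein expansion are bounded by multiples of powers of [S]
    of degree at most 3. *)

Lemma is_derive_MVT (f df : R -> R) (a b : R) : a <= b ->
  (forall x : R, a <= x <= b -> is_derive x 1 f (df x)) ->
  exists2 c, a <= c <= b & f b - f a = df c * (b - a).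
Proof.
move=> ab fdf.
have [x||c] := @MVT_segment R f df a b ab.
- by rewrite in_itv/= => /andP[/ltW ? /ltW ?]; apply: fdf; apply/andP.
- apply: derivable_within_continuous => x; rewrite in_itv/= => xab.
  by have [] := fdf x xab.
- by rewrite in_itv/= => cab ?; exists c.
Qed.

Lemma is_derive_continuous (f : R -> R) (x d : R) : is_derive x 1 f d ->
  {for x, continuous f}.
Proof.
by move=> [dfx _]; apply: differentiable_continuous; exact/derivable1_diffP.
Qed.

Lemma is_derive_homo (f df : R -> R) :
  (forall x : R, is_derive x 1 f (df x)) -> (forall x, 0 <= df x) ->
  {homo f : x y / x <= y}.
Proof.
move=> fdf df0 x y xy; rewrite -subr_ge0.
have [c _ ->] := is_derive_MVT xy (fun z _ => fdf z).
by rewrite mulr_ge0 ?subr_ge0.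
Qed.

(** Only the growth of [df] away from the base point is assumed, so that the bound serves both the
    Stein solution and the score. The mean value theorem is applied on [[0, 1]] to a function whose
    derivative is nonpositive. *)
Lemma is_derive_taylor_le (f df : R -> R) (x y K : R) :
  (forall t, 0 <= t <= 1 ->
    is_derive (x + t * (y - x)) 1 f (df (x + t * (y - x)))) ->
  (forall t, 0 <= t <= 1 ->
    `|df (x + t * (y - x)) - df x| <= K * `|t * (y - x)|) ->
  `|f y - f x - df x * (y - x)| <= K / 2 * (y - x) ^+ 2.
Proof.
move=> fdf dfK; set dl := y - x.
(* Taking [s] equal to 1 and to -1 yields both sides of the absolute value from one argument. *)
suff H s : `|s| <= 1 -> s * (f y - f x - df x * dl) <= K / 2 * dl ^+ 2.
  have := H 1; have := H (-1); rewrite normrN normr1 mulN1r mul1r => /(_ (lexx _)) ? /(_ (lexx _)) ?.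
  by rewrite ler_norml; apply/andP; split; lra.
move=> s1; pose l t := x + t * dl.
pose psi := (fun t => s * (f (l t) - df x * (t * dl)) - K / 2 * dl ^+ 2 * t ^+ 2).
have dl_ (t : R) : is_derive t 1 l dl.
  by apply: is_derive_eq; rewrite /GRing.scale/=; ring.
have dpsi (t : R) : 0 <= t <= 1 -> is_derive t 1 psi
    (s * (df (l t) * dl - df x * dl) - K * dl ^+ 2 * t).
  move=> t01; have d1 := @is_derive1_comp R f l t _ _ (fdf t t01) (dl_ t).
  have d2 : is_derive t 1 (fun t => s * (f (l t) - df x * (t * dl)))
      (s * (df (l t) * dl - df x * dl)).
    have -> : (fun t => s * (f (l t) - df x * (t * dl))) =
       s *: ((f \o l) - (df x * dl) *: id).
      by apply/funext => u /=; rewrite /GRing.scale/= !fctE/= /GRing.scale/=; ring.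
    by apply: is_derive_eq; rewrite /GRing.scale/=; ring.
  have d3 : is_derive t 1 (fun t => K / 2 * dl ^+ 2 * t ^+ 2) (K * dl ^+ 2 * t).
    by apply: is_derive_eq; rewrite /GRing.scale/=; field.
  exact: is_deriveB.
have [c c01] := is_derive_MVT (@ler01 R) dpsi.
rewrite subr0 mulr1 /psi /l !mul0r !mul1r !addr0 expr0n/= !mulr0 !subr0 expr1n mulr1.
rewrite -/(l c) {1 2}/dl subrKC => E.
have : s * (df (l c) * dl - df x * dl) <= K * dl ^+ 2 * c.
  rewrite (le_trans (ler_norm _))// normrM -mulrBl normrM.
  rewrite (le_trans (ler_piMl _ s1)) ?mulr_ge0//.
  have := ler_wpM2r (normr_ge0 dl) (dfK c c01).
  rewrite normrM (ger0_norm (_ : 0 <= c)); last by case/andP : c01.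
  have -> : K * dl ^+ 2 * c = K * (c * `|dl|) * `|dl|.
    by rewrite -[dl ^+ 2]real_normK ?num_real//; ring.
  by [].
move: E; rewrite -/dl; lra.
Qed.

End RealLemmas.

(** * The standard normal density: tail integrals and the law it defines *)

Section StandardNormal.
Context {R : realType}.
Local Notation mu := (@lebesgue_measure R).
Local Notation p := (@normal_pdf R 0 1).
Implicit Types (f h : R -> R) (x y t : R).

Lemma std_normal_pdfE x : p x = normal_peak 1 * expR (- (x ^+ 2) / 2).
Proof.
by rewrite normal_pdfE ?oner_eq0// /normal_fun subr0 expr1n mulr2n.
Qed.

Lemma std_normal_pdf_gt0 x : 0 < p x.
Proof.
by rewrite std_normal_pdfE mulr_gt0 ?expR_gt0// normal_peak_gt0 ?oner_eq0.
Qed.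

Lemma std_normal_pdf_le1 x : p x <= 1.
Proof.
apply: (le_trans (normal_pdf_ub _ _ _)) => //.
have pi2 := @pi_ge2 R.
rewrite /normal_peak expr1n mul1r invf_le1 ?sqrtr_gt0; last by rewrite mulr2n; lra.
rewrite -[leLHS]sqrtr1 ler_wsqrtr// mulr2n; lra.
Qed.

Lemma is_derive_std_normal_pdf x : is_derive x 1 p (- x * p x).
Proof.
have -> : p = (fun x => normal_peak 1 * expR (- (x ^+ 2) / 2)).
  by apply/funext => z; exact: std_normal_pdfE.
apply: is_derive_eq.
rewrite /GRing.scale/=; by field.
Qed.

Lemma std_normal_pdf_even x : p (- x) = p x.
Proof. by rewrite !std_normal_pdfE sqrrN. Qed.

Lemma std_normal_pdf_cvg0 : p x @[x --> +oo] --> (0 : R).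
Proof.
have -> : p = (fun x => normal_peak 1 * expR (- (2^-1 * x ^+ 2))).
  by apply/funext => z; rewrite std_normal_pdfE mulNr [_ / 2]mulrC.
rewrite -[X in _ --> X](mulr0 (normal_peak 1)).
apply: cvgM; first exact: cvg_cst.
apply: (cvg_comp (fun x => 2^-1 * x ^+ 2) (fun x => expR (- x))).
  by apply: gt0_cvgMry; [rewrite invr_gt0|exact: cvgr_expr2].
exact: cvgr_expR.
Qed.

Lemma continuous_std_normal_pdf : continuous p.
Proof. by apply: continuous_normal_pdf; rewrite oner_eq0. Qed.

Lemma Rintegral_std_normal_pdf : \int[mu]_x p x = 1.
Proof. by rewrite /Rintegral integral_normal_pdf ?oner_eq0. Qed.

Lemma integrable_std_normal_pdf : mu.-integrable setT (EFin \o p).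
Proof. by apply: integrable_normal_pdf; rewrite oner_eq0. Qed.

(* [- p] is an antiderivative of [t p(t)] *)
Lemma integral_id_std_normal_pdf :
  (\int[mu]_(x in `[0%R, +oo[) (x * p x)%:E = (p 0)%:E)%E.
Proof.
rewrite (@ge0_continuous_FTC2y R _ (\- p) 0 0).
- by rewrite sub0e -EFinN opprK.
- by move=> x x0; rewrite mulr_ge0// normal_pdf_ge0.
- apply: continuous_subspaceT => x; apply: cvgM => //.
  exact: continuous_std_normal_pdf.
- rewrite -[X in _ --> X]oppr0; apply: cvgN; exact: std_normal_pdf_cvg0.
- by move=> x _; have [? _] := is_derive_std_normal_pdf x; exact: derivableN.
- apply: cvgN; apply: cvg_at_right_filter; exact: continuous_std_normal_pdf.
- move=> x _; rewrite derive1E.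
  have := is_derive_std_normal_pdf x => ?.
  by rewrite deriveN// derive_val mulNr opprK.
Qed.

Lemma integrable_id_std_normal_pdf :
  mu.-integrable setT (EFin \o (fun x => x * p x)).
Proof.
have mf : measurable_fun [set: R] (fun x : R => x * p x).
  by apply: measurable_funM => //; exact: measurable_normal_pdf.
apply/integrableP; split; first exact/measurable_EFinP.
under eq_integral do rewrite /= normrM (ger0_norm (normal_pdf_ge0 _ _ _)).
rewrite ge0_symfun_integralT.
- rewrite (_ : [set x | 0 <= x] = `[0, +oo[%classic); last by rewrite set_itvcy.
  under eq_integral => x.
    rewrite inE/= in_itv/= andbT => x0; rewrite ger0_norm//; over.
  by rewrite integral_id_std_normal_pdf -EFinM ltry.
- by move=> x; rewrite mulr_ge0// normal_pdf_ge0.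
- move=> x; apply: cvgM; last exact: continuous_std_normal_pdf.
  exact: norm_continuous.
- by move=> x /=; rewrite normrN std_normal_pdf_even.
Qed.

(** The integral plus [p] has derivative 0 and hence is constant; the constant is found at 0 by
    reflecting the integral over [[0, +oo[]. *)
Lemma Rintegral_id_std_normal_pdf x :
  \int[mu]_(t in `]-oo, x]) (t * p t) = - p x.
Proof.
have ig := integrable_id_std_normal_pdf.
pose G y := \int[mu]_(t in `]-oo, y]) (t * p t).
have dG y : is_derive y 1 G (y * p y).
  have [||||dG G'] := @continuous_FTC1 R (fun t => t * p t) -oo%O y (y + 1).
  - by rewrite ltrDl.
  - exact: integrableS ig.
  - by rewrite ltNyr.
  - by apply: cvgM => //; exact: continuous_std_normal_pdf.
  - by split; [exact: dG|rewrite -derive1E; exact: G'].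
have dGp y : is_derive y 1 (G \+ p) 0.
  have := is_derive_std_normal_pdf y => ?.
  apply: is_derive_eq; ring.
have G0 : G 0 = - p 0.
  (* The endpoint is written [- 0] to fit the substitution [t -> - t] on a half-line. *)
  rewrite /G /Rintegral -{1}oppr0.
  have -> : (\int[mu]_(t in `]-oo, (- 0)%R]) (t * p t)%:E =
     - \int[mu]_(t in `]-oo, (- 0)%R]) (- t * p t)%:E)%E.
    rewrite -integralN/=.
      by apply: eq_integral => t _; rewrite mulNr opprK.
    apply: integrable_add_def.
      exact: measurable_itv.
    have igN : mu.-integrable setT (fun t => (- t * p t)%:E).
      have := integrableN ig; apply: eq_integrable => // t _.
      by rewrite /= mulNr.
    exact: integrableS igN.
  rewrite ge0_integration_by_substitutionNy.
  - under eq_integral do rewrite /= opprK std_normal_pdf_even.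
    by rewrite integral_id_std_normal_pdf.
  - apply: continuous_subspaceT => t; apply: cvgM; last exact: continuous_std_normal_pdf.
    exact: cvgN.
  - by move=> t; rewrite in_itv/= oppr0 => t0; rewrite mulr_ge0 ?normal_pdf_ge0// oppr_ge0 ltW.
have := is_derive_0_is_cst x 0 dGp; rewrite /= G0 addNr /G => /eqP.
by rewrite addr_eq0 => /eqP.
Qed.

Lemma Rintegral_lray_rray (f : R -> R) (x : R) :
  mu.-integrable setT (EFin \o f) ->
  \int[mu]_(t in `]-oo, x]) f t + \int[mu]_(t in `]x, +oo[) f t =
  \int[mu]_t f t.
Proof.
move=> fi; rewrite -Rintegral_setU//=.
- by rewrite -itv_bndbnd_setU// set_itvE.
- by rewrite -itv_bndbnd_setU// set_itvE.
- apply/disj_setPS => y [/=]; rewrite 2!in_itv/= => yx.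
  by rewrite andbT ltNge yx.
Qed.

Lemma Rintegral_id_std_normal_pdfT : \int[mu]_t (t * p t) = 0.
Proof.
have ig := integrable_id_std_normal_pdf.
rewrite -(Rintegral_lray_rray 0 ig) Rintegral_id_std_normal_pdf.
rewrite Rintegral_itv_obnd_cbnd; last exact: integrableS ig.
by rewrite /Rintegral integral_id_std_normal_pdf /= addNr.
Qed.

Lemma Rintegral_id_std_normal_pdf_tail x :
  \int[mu]_(t in `]x, +oo[) (t * p t) = p x.
Proof.
have := Rintegral_lray_rray x integrable_id_std_normal_pdf.
rewrite Rintegral_id_std_normal_pdf Rintegral_id_std_normal_pdfT.
by move=> /eqP; rewrite addrC subr_eq0 => /eqP.
Qed.

Local Notation nu := (@normal_prob R 0 1).

(** The Radon-Nikodym derivative of the normal law agrees with [p] almost everywhere, since both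
    have the same integral over every measurable set. *)
Lemma ge0_integral_std_normal_prob (f : R -> \bar R) : measurable_fun setT f ->
  (forall x, 0 <= f x)%E ->
  (\int[nu]_x f x = \int[mu]_x (f x * (p x)%:E))%E.
Proof.
move=> mf f0.
have dom : nu `<< mu by exact: normal_prob_dominates.
rewrite -(Radon_Nikodym_SigmaFinite.change_of_variables dom f0)//.
apply: ae_eq_integral => //.
- apply: emeasurable_funM => //.
  exact: measurable_int (Radon_Nikodym_SigmaFinite.f_integrable dom).
- apply: emeasurable_funM => //; apply/measurable_EFinP.
  exact: measurable_normal_pdf.
- apply: ae_eqe_mul2l; apply: integral_ae_eq => //.
  + exact: Radon_Nikodym_SigmaFinite.f_integrable.
  + by apply/measurable_EFinP; exact: measurable_normal_pdf.
  + by move=> E _ mE; rewrite -Radon_Nikodym_SigmaFinite.f_integral.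
Qed.

Lemma integrable_std_normal_prob (h : R -> R) : measurable_fun setT h ->
  mu.-integrable setT (EFin \o (fun x => h x * p x)) ->
  nu.-integrable setT (EFin \o h).
Proof.
move=> mh /integrableP[_ ih]; apply/integrableP; split.
  exact/measurable_EFinP.
rewrite ge0_integral_std_normal_prob//=.
  apply: le_lt_trans ih; rewrite le_eqVlt; apply/orP; left; apply/eqP.
  apply: eq_integral => x _.
  by rewrite -EFinM /= normrM (ger0_norm (normal_pdf_ge0 _ _ _)).
by apply/measurable_EFinP; exact: measurableT_comp.
Qed.

Lemma Rintegral_std_normal_prob (h : R -> R) : measurable_fun setT h ->
  mu.-integrable setT (EFin \o (fun x => h x * p x)) ->
  \int[nu]_x h x = \int[mu]_x (h x * p x).
Proof.
move=> mh ih; rewrite /Rintegral integralE [in RHS]integralE.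
rewrite !ge0_integral_std_normal_prob//.
- congr (fine (_ - _)); apply: eq_integral => x _.
  + rewrite !funeposE/= -!EFin_max -EFinM.
    by rewrite maxr_pMl ?normal_pdf_ge0// mul0r.
  + rewrite !funenegE/= -!EFin_max -EFinM.
    by rewrite -mulNr maxr_pMl ?normal_pdf_ge0// mul0r.
- by apply: measurable_funeneg; exact/measurable_EFinP.
- by apply: measurable_funepos; exact/measurable_EFinP.
Qed.

End StandardNormal.

(** * The Stein equation *)

Definition lip1 {R : realType} (h : R -> R) :=
  forall x y, `|h x - h y| <= `|x - y|.

Section Lipschitz.
Context {R : realType}.
Implicit Types (h : R -> R).

Lemma lip1_continuous h : lip1 h -> continuous h.
Proof.
move=> lh x; apply/cvgrPdist_le => e e0; near=> t.
apply: le_trans (lh _ _) _; near: t.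
by apply: (@cvgr_dist_le _ _ _ _ _ (fun t : R => t)).
Unshelve. all: by end_near. Qed.

Lemma lip1_measurable h : lip1 h -> measurable_fun setT h.
Proof. by move=> /lip1_continuous/continuous_measurable_fun. Qed.

Lemma lip1N h : lip1 h -> lip1 (\- h).
Proof. by move=> lh x y /=; rewrite -opprD normrN. Qed.

Lemma lip1B h c : lip1 h -> lip1 (fun x => h x - c).
Proof. by move=> lh x y; rewrite opprD addrACA subrr addr0. Qed.

Lemma lip1_growth h x : lip1 h -> `|h x| <= `|h 0| + `|x|.
Proof.
move=> lh; have := lh x 0; rewrite subr0; move: (ler_normD (h x - h 0) (h 0)).
by rewrite subrK; lra.
Qed.

End Lipschitz.

Section SteinEquation.
Context {R : realType}.
Local Notation mu := (@lebesgue_measure R).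
Local Notation p := (@normal_pdf R 0 1).
Implicit Types (g : R -> R) (x y t : R).

Lemma integrable_lip1_std_normal_pdf g : lip1 g ->
  mu.-integrable setT (EFin \o (fun x => g x * p x)).
Proof.
move=> lg; have ip := @integrable_std_normal_pdf R.
have iip := @integrable_id_std_normal_pdf R.
have i1 : mu.-integrable setT (EFin \o (fun x => `|g 0| * p x)).
  have := @integrableZl _ _ _ mu setT measurableT `|g 0| _ ip.
  by apply: eq_integrable.
have i2 : mu.-integrable setT (EFin \o (fun x => `|x| * p x)).
  have := @integrable_abse _ _ _ mu setT _ iip.
  apply: eq_integrable => // x _ /=.
  by rewrite normrM (ger0_norm (normal_pdf_ge0 _ _ _)).
have := integrableD measurableT i1 i2; apply: le_integrable => //.
  apply/measurable_EFinP; apply: measurable_funM.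
    exact: lip1_measurable.
  exact: measurable_normal_pdf.
move=> x _ /=; rewrite lee_fin normrM (ger0_norm (normal_pdf_ge0 _ _ _)).
rewrite -mulrDl normrM (ger0_norm (normal_pdf_ge0 _ _ _)).
rewrite ler_wpM2r ?normal_pdf_ge0//.
apply: (le_trans (lip1_growth x lg)).
by rewrite ger0_norm// addr_ge0.
Qed.

(** The classical solution of [F' - x F = g], namely [exp (x^2 / 2)] times the integral of
    [g t exp (- t^2 / 2)] up to [x], written with [p] because the normalising constant cancels. *)
Definition stein g x : R :=
  (\int[mu]_(t in `]-oo, x]) (g t * p t)) / p x.

(** The value that the Stein equation prescribes for the derivative of [stein g]. *)
Definition dstein g x : R := x * stein g x + g x.

Section centered.
Variable g : R -> R.
Hypothesis lg : lip1 g.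
Hypothesis cg : \int[mu]_t (g t * p t) = 0.

Let ig := integrable_lip1_std_normal_pdf lg.
Let p0 x : p x != 0. Proof. by rewrite gt_eqF// std_normal_pdf_gt0. Qed.

(** Centering exchanges the lower half-line for the upper one, where pointwise comparison works when
    the lower one gives no sign. *)
Lemma steinE_tail x :
  stein g x = - (\int[mu]_(t in `]x, +oo[) (g t * p t)) / p x.
Proof.
rewrite /stein; congr (_ / _); apply/eqP; rewrite -subr_eq0 opprK.
by rewrite (Rintegral_lray_rray x ig) cg.
Qed.

Lemma is_derive_stein x : is_derive x 1 (stein g) (dstein g x).
Proof.
have dp := is_derive_std_normal_pdf x.
pose G y := \int[mu]_(t in `]-oo, y]) (g t * p t).
have dG : is_derive x 1 G (g x * p x).
  have [||||dG G'] := @continuous_FTC1 R (fun t => g t * p t) -oo%O x (x + 1).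
  - by rewrite ltrDl.
  - exact: integrableS ig.
  - by rewrite ltNyr.
  - apply: cvgM; first exact: lip1_continuous.
    exact: continuous_std_normal_pdf.
  - by split; [exact: dG|rewrite -derive1E; exact: G'].
have dV : is_derive x 1 (fun y => (p y)^-1) (x / p x).
  have dpx : derivable p x 1 by case: dp.
  split; first exact: derivableV.
  rewrite deriveV//= derive_val /GRing.scale/= !mulNr mulrN opprK.
  by rewrite expr2; field.
have dGV := @is_deriveM R _ G (fun y => (p y)^-1) x 1 _ _ dG dV.
have -> : stein g = G * (fun y => (p y)^-1) by [].
apply: (is_derive_eq dGV).
by rewrite /GRing.scale/= /dstein /stein -/(G x); field.
Qed.

End centered.

Section oneside.
Variable g : R -> R.
Hypothesis lg : lip1 g.
Hypothesis cg : \int[mu]_t (g t * p t) = 0.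
Let ig := integrable_lip1_std_normal_pdf lg.
Let iid : mu.-integrable setT (EFin \o (fun x => x * p x)) :=
  @integrable_id_std_normal_pdf R.
Let ip : mu.-integrable setT (EFin \o p) := @integrable_std_normal_pdf R.

Let lgD x t : g t <= g x + `|x - t|.
Proof. have := lg t x; rewrite ler_norml distrC => /andP[_]; lra. Qed.

(* [g + id] is nondecreasing and centered, so it has a nonpositive integral
   against [p] on every lower half-line. *)
Lemma stein_le1 x : stein g x <= 1.
Proof.
rewrite -subr_le0 -(pmulr_rle0 _ (std_normal_pdf_gt0 x)).
have pu : p x \is a GRing.unit by rewrite unitfE gt_eqF ?std_normal_pdf_gt0.
have iD : mu.-integrable setT (EFin \o (fun t => (g t + t) * p t)).
  by have := integrableD measurableT ig iid; apply: eq_integrable => // t _ /=;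
    rewrite -EFinD mulrDl.
(* By monotonicity of [g + id], its sign at [x] persists on the lower half-line if it is nonpositive
   and on the upper one if it is positive; the corresponding tail formula is used. *)
have [gx|gx] := leP (g x + x) 0.
  have -> : p x * (stein g x - 1) = \int[mu]_(t in `]-oo, x]) ((g t + t) * p t).
    under eq_Rintegral do rewrite mulrDl.
    rewrite RintegralD//; last 2 first.
      exact: integrableS ig.
      exact: integrableS iid.
    by rewrite Rintegral_id_std_normal_pdf mulrBr mulr1 /stein mulrCA divrr// mulr1.
  rewrite -oppr_ge0 -(mulN1r (Rintegral _ _ _)) -RintegralZl//; last exact: integrableS iD.
  apply: Rintegral_ge0 => t; rewrite /= in_itv/= => tx.
  rewrite mulN1r -mulNr mulr_ge0 ?normal_pdf_ge0// oppr_ge0.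
  by have := lgD x t; rewrite ger0_norm ?subr_ge0//; lra.
have -> : p x * (stein g x - 1) = - \int[mu]_(t in `]x, +oo[) ((g t + t) * p t).
  under eq_Rintegral do rewrite mulrDl.
  rewrite RintegralD//; last 2 first.
    exact: integrableS ig.
    exact: integrableS iid.
  by rewrite Rintegral_id_std_normal_pdf_tail mulrBr mulr1 (steinE_tail lg cg) mulrCA divrr// mulr1 opprD.
rewrite oppr_le0; apply: Rintegral_ge0 => t; rewrite /= in_itv/= andbT => xt.
rewrite mulr_ge0 ?normal_pdf_ge0//.
by have := lg x t; rewrite ler_norml (ltr0_norm (_ : x - t < 0)) ?subr_lt0// => /andP[]; lra.
Qed.

Let Phi x := \int[mu]_(t in `]-oo, x]) p t.

Let is_derive_Phi x : is_derive x 1 Phi (p x).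
Proof.
have [||||dG G'] := @continuous_FTC1 R p -oo%O x (x + 1).
- by rewrite ltrDl.
- exact: integrableS ip.
- by rewrite ltNyr.
- exact: continuous_std_normal_pdf.
- by split; [exact: dG|rewrite -derive1E; exact: G'].
Qed.

Let PhiD x : Phi x + \int[mu]_(t in `]x, +oo[) p t = 1.
Proof. by rewrite (Rintegral_lray_rray x ip) Rintegral_std_normal_pdf. Qed.

Let K x := Phi x + x * p x / (1 + x ^+ 2).

Let q_neq0 x : 1 + x ^+ 2 != 0.
Proof. by rewrite gt_eqF// ltr_pwDl// sqr_ge0. Qed.

(** The denominator [1 + x^2] makes the powers of [x] in the numerator of the derivative cancel,
    leaving the nonnegative [2 p / (1 + x^2)^2]. *)
Let K_homo : {homo K : x y / x <= y}.
Proof.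
apply: (@is_derive_homo _ _ (fun x => 2 * p x / (1 + x ^+ 2) ^+ 2)) => [x|x]; last first.
  by rewrite divr_ge0 ?sqr_ge0// mulr_ge0// normal_pdf_ge0.
have dp := is_derive_std_normal_pdf x.
have dPhi := is_derive_Phi x.
have dq : is_derive x 1 (fun y => 1 + y ^+ 2) (2 * x).
  apply: is_derive_eq; rewrite /GRing.scale/=; ring.
have dV : is_derive x 1 (fun y => (1 + y ^+ 2)^-1) (- (2 * x) / (1 + x ^+ 2) ^+ 2).
  have dqx : derivable (fun y => 1 + y ^+ 2) x 1 by case: dq.
  split; first exact: derivableV.
  rewrite deriveV//= derive_val /GRing.scale/=; by field.
have d1 := @is_deriveM R _ id p x 1 _ _ (is_derive_id x 1) dp.
have d2 := @is_deriveM R _ (id * p) (fun y => (1 + y ^+ 2)^-1) x 1 _ _ d1 dV.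
have d3 := @is_deriveD R _ _ Phi ((id * p) * (fun y => (1 + y ^+ 2)^-1)) x 1 _ _ dPhi d2.
have -> : K = Phi + (id * p) * (fun y => (1 + y ^+ 2)^-1) by [].
apply: (is_derive_eq d3).
by rewrite /GRing.scale/= fctE; field.
Qed.

(** Quantitative substitute for the limits of [K]: as [p <= 1], its rational term is below [1 / a]
    at [a]. *)
Let far_bound (e a : R) : 0 < e -> e^-1 <= a -> a * p a / (1 + a ^+ 2) < e.
Proof.
move=> e0 ea; have a0 : 0 < a by apply: lt_le_trans ea; rewrite invr_gt0.
have ea1 : 1 <= a * e by rewrite -ler_pdivrMr// div1r.
rewrite ltr_pdivrMr ?ltr_pwDl ?sqr_ge0//.
have : a * p a <= a by rewrite ler_piMr ?std_normal_pdf_le1// ltW.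
by have : a <= a * (a * e) by [rewrite ler_peMr// ltW]; nra.
Qed.

(* Lower bounds for the Mills ratio on both tails; [K] is nondecreasing with
   limits 0 and 1. *)
Let K_ge0 x : 0 <= K x.
Proof.
rewrite leNgt; apply/negP => Kx0.
have e0 : 0 < - K x by rewrite oppr_gt0.
(* The point [- a] lies to the left of [x], and so far out that the rational term exceeds [K x].
   Since [Phi] is nonnegative, [K (- a) > K x], against monotonicity. *)
pose a := Num.max (- x) (- K x)^-1.
have : K (- a) <= K x by apply: K_homo; rewrite lerNl /a le_max lexx.
rewrite {1}/K std_normal_pdf_even sqrrN mulNr mulNr.
have := @far_bound (- K x) a e0; rewrite /a le_max lexx orbT => /(_ isT).
have : 0 <= Phi (- a) by apply: Rintegral_ge0 => t _; exact: normal_pdf_ge0.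
rewrite -/a; lra.
Qed.

Let K_le1 x : K x <= 1.
Proof.
rewrite leNgt; apply/negP => Kx1.
have e0 : 0 < K x - 1 by rewrite subr_gt0.
pose a := Num.max x (K x - 1)^-1.
have : K x <= K a by apply: K_homo; rewrite /a le_max lexx.
rewrite {2}/K.
have := @far_bound (K x - 1) a e0; rewrite /a le_max lexx orbT => /(_ isT).
have := PhiD a.
have : 0 <= \int[mu]_(t in `]a, +oo[) p t.
  by apply: Rintegral_ge0 => t _; exact: normal_pdf_ge0.
rewrite -/a; lra.
Qed.

(* [x * stein g x] has derivative [stein g x + x * dstein g x] *)
Lemma stein_dstein_le1 x : stein g x + x * dstein g x <= 1.
Proof.
have s1 := stein_le1 x; have p0 := std_normal_pdf_gt0 x.
have q0 : 0 < 1 + x ^+ 2 by rewrite ltr_pwDl ?sqr_ge0.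
have K1 : x * p x <= (1 + x ^+ 2) * (1 - Phi x).
  by have := K_le1 x; rewrite /K -lerBrDl ler_pdivrMr// mulrC [_ * (1 - _)]mulrC.
have K0 : - (x * p x) <= (1 + x ^+ 2) * Phi x.
  have := K_ge0 x; rewrite /K -[in X in - X](divfK (q_neq0 x) (x * p x)); nra.
have iaff c : mu.-integrable setT (EFin \o (fun t => c * p t)).
  have := @integrableZl _ _ _ mu setT measurableT c _ ip.
  by apply: eq_integrable.
have iaffB c : mu.-integrable setT (EFin \o (fun t => c * p t - t * p t)).
  by have := integrableB measurableT (iaff c) iid; apply: eq_integrable.
(* The quantity equals [(1 + x^2) F + x g]. If [x] and [g x + x] have opposite signs, [F <= 1]
   suffices, since it leaves [1 + x (g x + x)]. Otherwise [g t] is compared with [g x + x - t] on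
   the tail on the side of [x], and the bounds [K1], [K0] finish. *)
rewrite /dstein; case: (leP 0 x) => x0; case: (leP 0 (g x + x)) => gx0; [|nra|nra|].
- have : (g x + x) * (1 - Phi x) - p x <= \int[mu]_(t in `]x, +oo[) (g t * p t).
    have -> : 1 - Phi x = \int[mu]_(t in `]x, +oo[) p t by have := PhiD x; lra.
    rewrite -Rintegral_id_std_normal_pdf_tail -RintegralZl//; last exact: integrableS ip.
    rewrite -RintegralB//; [|exact: integrableS (iaff _)|exact: integrableS iid].
    apply: le_Rintegral => //; [|exact: integrableS ig|].
      exact: integrableS (iaffB _).
    move=> t; rewrite /= in_itv/= andbT => xt; rewrite -mulrBl ler_wpM2r ?normal_pdf_ge0//.
    by have := lg x t; rewrite ler_norml (ltr0_norm (_ : x - t < 0)) ?subr_lt0// => /andP[]; lra.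
  have -> : \int[mu]_(t in `]x, +oo[) (g t * p t) = - (stein g x * p x).
    by rewrite (steinE_tail lg cg) divfK ?gt_eqF// opprK.
  move=> H; rewrite -(ler_pM2r p0).
  have := ler_wpM2l (ltW q0) H; have := ler_wpM2l gx0 K1; lra.
- have : stein g x * p x <= (g x + x) * Phi x + p x.
    rewrite /stein divfK ?gt_eqF// -[X in _ + X]opprK -Rintegral_id_std_normal_pdf.
    rewrite -RintegralZl//; last exact: integrableS ip.
    rewrite -RintegralB//; [|exact: integrableS (iaff _)|exact: integrableS iid].
    apply: le_Rintegral => //; [exact: integrableS ig| |].
      exact: integrableS (iaffB _).
    move=> t; rewrite /= in_itv/= => tx; rewrite -mulrBl ler_wpM2r ?normal_pdf_ge0//.
    by have := lgD x t; rewrite ger0_norm ?subr_ge0//; lra.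
  move=> H; rewrite -(ler_pM2r p0).
  have := ler_wpM2l (ltW q0) H; have := ler_wnM2l (ltW gx0) K0; lra.
Qed.

End oneside.

(** Turns upper bounds into two-sided ones, as [- g] is again Lipschitz and centered. *)
Lemma steinN g x : lip1 g -> stein (\- g) x = - stein g x.
Proof.
move=> lg; rewrite /stein -mulNr; congr (_ / _).
have ig := integrable_lip1_std_normal_pdf lg.
rewrite -mulN1r -RintegralZl//; last exact: integrableS ig.
by apply: eq_Rintegral => t _ /=; rewrite mulN1r mulNr.
Qed.

Section bounds.
Variable g : R -> R.
Hypothesis lg : lip1 g.
Hypothesis cg : \int[mu]_t (g t * p t) = 0.

Let cgN : \int[mu]_t ((\- g) t * p t) = 0.
Proof.
under eq_Rintegral do rewrite /= mulNr -mulN1r.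
rewrite RintegralZl ?cg ?mulr0//; exact: integrable_lip1_std_normal_pdf.
Qed.

Lemma stein_bounded x : `|stein g x| <= 1.
Proof.
rewrite ler_norml stein_le1// andbT lerNl -steinN//.
exact: stein_le1 (lip1N lg) cgN x.
Qed.

(** One unit comes from [x F], whose derivative has absolute value at most 1, and one from [g]
    itself, which is not differentiated. *)
Lemma dstein_lipschitz x y : `|dstein g x - dstein g y| <= 2 * `|x - y|.
Proof.
wlog yx : x y / y <= x.
  move=> H; case: (leP y x) => [/H //|/ltW/H]; by rewrite distrC [X in _ <= _ * X]distrC.
have dx (z : R) : is_derive z 1 (fun z => z * stein g z) (stein g z + z * dstein g z).
  have ds := is_derive_stein lg z.
  have dM := @is_deriveM R _ id (stein g) z 1 _ _ (is_derive_id z 1) ds.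
  apply: (is_derive_eq dM); rewrite /GRing.scale/= ; ring.
have [c _ E] := is_derive_MVT yx (fun z _ => dx z).
have u1 : `|stein g c + c * dstein g c| <= 1.
  rewrite ler_norml stein_dstein_le1// andbT lerNl.
  have := stein_dstein_le1 (lip1N lg) cgN c.
  by rewrite /dstein steinN//=; lra.
rewrite /dstein opprD addrACA (le_trans (ler_normD _ _))// mulr_natl mulr2n lerD//.
by rewrite E normrM ler_piMl.
Qed.

End bounds.

End SteinEquation.

(** * Stein's method under local dependence *)

Section Integrable.
Context {d : measure_display} {T : measurableType d} {R : realType}.
Variable P : probability T R.

Definition integrableR (f : T -> R) : bool := P.-integrable setT (EFin \o f).

Local Notation "\E f" := (Rintegral P setT f) (at level 10, f at level 8).

Lemma integrableR_le (f g : T -> R) : measurable_fun setT f ->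
  integrableR g -> (forall w, `|f w| <= g w) -> integrableR f.
Proof.
move=> mf ig fg; apply: le_integrable ig => //; first exact/measurable_EFinP.
by move=> w _ /=; rewrite lee_fin (le_trans (fg w))// ler_norm.
Qed.

Lemma integrableRD (f g : T -> R) : integrableR f -> integrableR g ->
  integrableR (fun w => f w + g w).
Proof. by move=> i1 i2; have := integrableD measurableT i1 i2; exact: eq_integrable. Qed.

Lemma integrableRZ (c : R) (f : T -> R) : integrableR f ->
  integrableR (fun w => c * f w).
Proof. by move=> i1; have := integrableZl measurableT c i1; exact: eq_integrable. Qed.

Lemma integrableR_cst (c : R) : integrableR (fun=> c).
Proof. exact: finite_measure_integrable_cst. Qed.

Lemma integrableR_measurable (f : T -> R) : integrableR f -> measurable_fun setT f.
Proof. by move=> /integrableP[/measurable_EFinP]. Qed.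

Lemma integrableR_norm (f : T -> R) : integrableR f -> integrableR (fun w => `|f w|).
Proof.
move=> i1; apply: (@integrableR_le _ (fun w => `|f w|)).
- by apply: measurableT_comp => //; exact: integrableR_measurable.
- by have := integrable_abse i1; exact: eq_integrable.
- by move=> w; rewrite normr_id.
Qed.

Lemma integrableR_sum (I : Type) (s : seq I) (f : I -> T -> R) :
  (forall i, integrableR (f i)) -> integrableR (fun w => \sum_(i <- s) f i w).
Proof.
move=> fi; have := @integrable_sum _ _ _ P setT measurableT _ s xpredT _ (fun i _ => fi i).
by apply: eq_integrable => // w _ /=; rewrite sumEFin.
Qed.

Lemma expD (f g : T -> R) : integrableR f -> integrableR g ->
  \E (fun w => f w + g w) = \E f + \E g.
Proof. exact: RintegralD. Qed.

Lemma expB (f g : T -> R) : integrableR f -> integrableR g ->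
  \E (fun w => f w - g w) = \E f - \E g.
Proof. exact: RintegralB. Qed.

Lemma expZ (c : R) (f : T -> R) : integrableR f ->
  \E (fun w => c * f w) = c * \E f.
Proof. exact: RintegralZl. Qed.

Lemma exp_cst (c : R) : \E (fun=> c) = c.
Proof. by rewrite Rintegral_cst//= probability_setT mulr1. Qed.

Lemma exp_sum (I : Type) (s : seq I) (f : I -> T -> R) :
  (forall i, integrableR (f i)) ->
  \E (fun w => \sum_(i <- s) f i w) = \sum_(i <- s) \E (f i).
Proof.
move=> fi; elim: s => [|i s IH].
  by rewrite big_nil; under eq_Rintegral do rewrite big_nil; rewrite exp_cst.
rewrite big_cons -IH -expD//; last exact: integrableR_sum.
by under eq_Rintegral do rewrite big_cons.
Qed.

Lemma exp_le (f g : T -> R) : integrableR f -> integrableR g ->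
  (forall w, f w <= g w) -> \E f <= \E g.
Proof. by move=> fi gi fg; apply: le_Rintegral. Qed.

Lemma exp_ge0 (f : T -> R) : (forall w, 0 <= f w) -> 0 <= \E f.
Proof. by move=> f0; exact: Rintegral_ge0. Qed.

Lemma exp_norm_le (f g : T -> R) : integrableR f -> integrableR g ->
  (forall w, `|f w| <= g w) -> `|\E f| <= \E g.
Proof.
move=> fi gi fg; apply: (le_trans (le_normr_Rintegral _ fi)) => //.
by apply: exp_le => //; exact: integrableR_norm.
Qed.

End Integrable.

Section LocalDependence.
Context {d : measure_display} {T : measurableType d} {R : realType}.
Variable P : probability T R.
Local Notation "\E f" := (Rintegral P setT f) (at level 10, f at level 8).

Variable S : T -> R.
Hypothesis S1 : forall w, 1 <= S w.
Hypothesis iS4 : integrableR P (fun w => S w ^+ 4).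

(** Degree count for integrability: [S] is an envelope with integrable fourth power, products add
    degrees, and anything of degree at most 4 is integrable because [S >= 1]. *)
Definition ordS (k : nat) (f : T -> R) :=
  measurable_fun setT f /\ exists C, 0 <= C /\ forall w, `|f w| <= C * S w ^+ k.

Lemma ordS_integrable k f : (k <= 4)%N -> ordS k f -> integrableR P f.
Proof.
move=> k4 [mf [C [C0 fC]]].
apply: (@integrableR_le _ _ _ _ _ (fun w => C * S w ^+ 4)) => //.
  exact: integrableRZ.
by move=> w; rewrite (le_trans (fC w))// ler_wpM2l// ler_weXn2l.
Qed.

Lemma ordS_cst c k : ordS k (fun=> c).
Proof.
split; first exact: measurable_cst.
exists `|c|; split=> // w; rewrite ler_peMr// exprn_ege1//.
Qed.

Lemma ordSD k f g : ordS k f -> ordS k g -> ordS k (fun w => f w + g w).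
Proof.
move=> [mf [C [C0 fC]]] [mg [D [D0 gD]]]; split; first exact: measurable_funD.
exists (C + D); split=> [|w]; first exact: addr_ge0.
by rewrite (le_trans (ler_normD _ _))// mulrDl lerD.
Qed.

Lemma ordSM k l f g : ordS k f -> ordS l g -> ordS (k + l) (fun w => f w * g w).
Proof.
move=> [mf [C [C0 fC]]] [mg [D [D0 gD]]]; split; first exact: measurable_funM.
exists (C * D); split=> [|w]; first exact: mulr_ge0.
by rewrite normrM exprD mulrACA ler_pM.
Qed.

Lemma ordSB k f g : ordS k f -> ordS k g -> ordS k (fun w => f w - g w).
Proof.
move=> of_ og; have := ordSD of_ (ordSM (ordS_cst (-1) 0) og).
by congr ordS; apply/funext => w; rewrite mulN1r.
Qed.

Lemma ordS_norm k f : ordS k f -> ordS k (fun w => `|f w|).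
Proof.
move=> [mf [C [C0 fC]]]; split; first exact: measurableT_comp.
by exists C; split=> // w; rewrite normr_id.
Qed.

Lemma ordS_sum k (I : Type) (s : seq I) (f : I -> T -> R) :
  (forall i, ordS k (f i)) -> ordS k (fun w => \sum_(i <- s) f i w).
Proof.
move=> fk; elim: s => [|i s IH].
  by have := ordS_cst 0 k; congr ordS; apply/funext => w; rewrite big_nil.
have := ordSD (fk i) IH; congr ordS; apply/funext => w; by rewrite big_cons.
Qed.

Lemma ordS_comp f (phi : R -> R) a : ordS 1 f -> measurable_fun setT phi ->
  (forall x, `|phi x| <= a * (1 + `|x|)) -> ordS 1 (phi \o f).
Proof.
move=> [mf [C [C0 fC]]] mphi phia; split; first exact: measurableT_comp.
have a0 : 0 <= a by have := phia 0; rewrite normr0 addr0 mulr1; exact: le_trans.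
exists (a * (1 + C)); split=> [|w]; first by rewrite mulr_ge0// addr_ge0.
rewrite (le_trans (phia _))// -mulrA ler_wpM2l// mulrDl mul1r lerD//.
by rewrite expr1.
Qed.

Variables (I : seq nat) (A B : nat -> seq nat) (zeta : nat -> T -> R).
Let W w := \sum_(i <- I) zeta i w.
Let eta i w := \sum_(j <- A i) zeta j w.
Let tau i w := \sum_(k <- B i) zeta k w.
Hypothesis ozeta : forall i, ordS 1 (zeta i).
Hypothesis zeta0 : forall i, \E (zeta i) = 0.
Hypothesis W1 : \E (fun w => W w ^+ 2) = 1.
(** Independence enters only as factorisation of expectations. Linear growth of the test function
    admits [id], [F] and [dF], the three choices made below. *)
Hypothesis indep1 : forall i (phi : R -> R) a, i \in I ->
  measurable_fun setT phi -> (forall x, `|phi x| <= a * (1 + `|x|)) ->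
  \E (fun w => zeta i w * phi (W w - eta i w)) =
  \E (zeta i) * \E (fun w => phi (W w - eta i w)).
Hypothesis indep2 : forall i j (phi : R -> R) a, i \in I -> j \in A i ->
  measurable_fun setT phi -> (forall x, `|phi x| <= a * (1 + `|x|)) ->
  \E (fun w => zeta i w * zeta j w * phi (W w - tau i w)) =
  \E (fun w => zeta i w * zeta j w) * \E (fun w => phi (W w - tau i w)).

Let oW : ordS 1 W. Proof. exact: ordS_sum. Qed.
Let oeta i : ordS 1 (eta i). Proof. exact: ordS_sum. Qed.
Let otau i : ordS 1 (tau i). Proof. exact: ordS_sum. Qed.

Variable g : R -> R.
Hypothesis lg : lip1 g.
Hypothesis cg : \int[lebesgue_measure]_t (g t * normal_pdf 0 1 t) = 0.

Let F := stein g.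
Let dF := dstein g.

Let mF : measurable_fun setT F.
Proof.
apply: continuous_measurable_fun => x.
exact: is_derive_continuous (is_derive_stein lg x).
Qed.

Let mdF : measurable_fun setT dF.
Proof.
by apply: measurable_funD; [exact: measurable_funM|exact: lip1_measurable].
Qed.

Let bF x : `|F x| <= 1 * (1 + `|x|).
Proof. by rewrite mul1r (le_trans (stein_bounded lg cg x))// lerDl. Qed.

Let bdF x : `|dF x| <= (`|dF 0| + 2) * (1 + `|x|).
Proof.
have := dstein_lipschitz lg cg x 0; rewrite subr0 -/dF => H.
have := ler_normD (dF x - dF 0) (dF 0); rewrite subrK => H2.
have := normr_ge0 x; have := normr_ge0 (dF 0); nra.
Qed.

Let F_taylor x y : `|F x - F y - (x - y) * dF x| <= (x - y) ^+ 2.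
Proof.
have T2 : `|F y - F x - dF x * (y - x)| <= 2 / 2 * (y - x) ^+ 2.
  apply: is_derive_taylor_le => t _; first exact: is_derive_stein.
  rewrite (le_trans (dstein_lipschitz lg cg _ _))//.
  by rewrite [x + _]addrC addrK.
move: T2; rewrite divff// mul1r -[(y - x) ^+ 2]sqrrN opprB; apply: le_trans.
by rewrite -normrN le_eqVlt; apply/orP; left; apply/eqP; congr `|_|; ring.
Qed.

Let oFW : ordS 1 (F \o W). Proof. exact: ordS_comp bF. Qed.
Let odFW : ordS 1 (dF \o W). Proof. exact: ordS_comp bdF. Qed.

Let oWe i : ordS 1 (fun w => W w - eta i w). Proof. exact: ordSB. Qed.
Let oWt i : ordS 1 (fun w => W w - tau i w). Proof. exact: ordSB. Qed.

(** In [E (W^2)], the sum of the [E (zeta_i W)], the part [W - eta_i] of [W] is uncorrelated with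
    the centered [zeta_i], so only [eta_i] survives. *)
Let sum_E_zeta_eta : \sum_(i <- I) \sum_(j <- A i) \E (fun w => zeta i w * zeta j w) = 1.
Proof.
rewrite -W1.
have -> : \E (fun w => W w ^+ 2) = \E (fun w => \sum_(i <- I) zeta i w * W w).
  by apply: eq_Rintegral => w _; rewrite expr2 {1}/W mulr_suml.
rewrite exp_sum; last by move=> i; apply: (@ordS_integrable 2) => //; exact: (@ordSM 1 1).
apply: eq_big_seq => i iI.
have := @indep1 i id 1 iI _ _; rewrite zeta0 mul0r => H.
have -> : \E (fun w => zeta i w * W w) =
    \E (fun w => zeta i w * (W w - eta i w) + zeta i w * eta i w).
  by apply: eq_Rintegral => w _; rewrite -mulrDr subrK.
rewrite expD; last 2 first.
- by apply: (@ordS_integrable 2) => //; exact: (@ordSM 1 1).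
- by apply: (@ordS_integrable 2) => //; exact: (@ordSM 1 1).
rewrite H ?add0r//; last by move=> x; rewrite mul1r lerDr.
rewrite -exp_sum; last by move=> j; apply: (@ordS_integrable 2) => //; exact: (@ordSM 1 1).
by apply: eq_Rintegral => w _; rewrite mulr_sumr.
Qed.

(** [zeta_i F (W - eta_i)] has mean zero and may be subtracted; the increment of [F] is then
    expanded to first order with its slope at [W], at a cost of [eta_i^2]. *)
Let E_WF : `|\E (fun w => W w * F (W w)) -
    \sum_(i <- I) \E (fun w => zeta i w * eta i w * dF (W w))|
  <= \sum_(i <- I) \E (fun w => `|zeta i w| * eta i w ^+ 2).
Proof.
have oFWe i : ordS 1 (F \o (fun w => W w - eta i w)) by exact: ordS_comp bF.
have -> : \E (fun w => W w * F (W w)) = \E (fun w => \sum_(i <- I) zeta i w * F (W w)).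
  by apply: eq_Rintegral => w _; rewrite mulr_suml.
rewrite exp_sum; last by move=> i; apply: (@ordS_integrable 2) => //; exact: (@ordSM 1 1).
rewrite -sumrB (le_trans (ler_norm_sum _ _ _))// big_seq [leRHS]big_seq.
apply: ler_sum => i iI.
have := @indep1 i F 1 iI mF bF; rewrite zeta0 mul0r => H.
have i1 : integrableR P (fun w => zeta i w * F (W w)).
  by apply: (@ordS_integrable 2) => //; exact: (@ordSM 1 1).
have o2 : ordS 2 (fun w => zeta i w * F (W w - eta i w)).
  exact: (@ordSM 1 1 _ (F \o (fun w => W w - eta i w))).
have i2 := @ordS_integrable 2 _ isT o2.
have i3 : integrableR P (fun w => zeta i w * eta i w * dF (W w)).
  apply: (@ordS_integrable 3) => //; apply: (@ordSM 2 1) => //; exact: (@ordSM 1 1).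
have i12 : integrableR P (fun w => zeta i w * F (W w) - zeta i w * F (W w - eta i w)).
  by apply: (@ordS_integrable 2) => //; apply: ordSB => //; exact: (@ordSM 1 1).
rewrite -[X in `|X - _|]subr0 -H -expB// -expB//.
apply: exp_norm_le.
- apply: (@ordS_integrable 3) => //; apply: ordSB.
    (* Multiplication by the constant 1, viewed as a term of order 1, raises the order from 2 to 3
       to match the other summand. *)
    have -> : (fun w => zeta i w * F (W w) - zeta i w * F (W w - eta i w)) =
       (fun w => 1 * (zeta i w * F (W w) - zeta i w * F (W w - eta i w))).
      by apply/funext => w; rewrite mul1r.
    apply: (@ordSM 1 2); first exact: ordS_cst.
    by apply: ordSB => //; exact: (@ordSM 1 1).
  by apply: (@ordSM 2 1) => //; exact: (@ordSM 1 1).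
- apply: (@ordS_integrable 3) => //; apply: (@ordSM 1 2); first exact: ordS_norm.
  have -> : (fun w => eta i w ^+ 2) = (fun w => eta i w * eta i w) by [].
  exact: (@ordSM 1 1).
- move=> w; rewrite -mulrBr -mulrA -mulrBr normrM ler_wpM2l//.
  by have := F_taylor (W w) (W w - eta i w); rewrite subKr.
Qed.

(** The weights [E (zeta_i zeta_j)] sum to 1, so [E dF (W)] can be distributed over the pairs. For
    each pair, replacing [W] by [W - tau_i] makes the two sides equal by independence, and each
    replacement costs at most twice the sum of the [|zeta_k|], as [dF] is 2-Lipschitz. *)
Let E_dF : `|\E (fun w => dF (W w)) -
    \sum_(i <- I) \E (fun w => zeta i w * eta i w * dF (W w))|
  <= 2 * \sum_(i <- I) \sum_(j <- A i) \sum_(k <- B i)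
     (\E (fun w => `|zeta i w * zeta j w * zeta k w|) +
      `|\E (fun w => zeta i w * zeta j w)| * \E (fun w => `|zeta k w|)).
Proof.
have odFWt i : ordS 1 (dF \o (fun w => W w - tau i w)) by exact: ordS_comp bdF.
have ozz i j : ordS 2 (fun w => zeta i w * zeta j w) by exact: (@ordSM 1 1).
have izzd i j : integrableR P (fun w => zeta i w * zeta j w * dF (W w)).
  by apply: (@ordS_integrable 3) => //; exact: (@ordSM 2 1).
have E1 i : \E (fun w => zeta i w * eta i w * dF (W w)) =
    \sum_(j <- A i) \E (fun w => zeta i w * zeta j w * dF (W w)).
  rewrite -exp_sum//; apply: eq_Rintegral => w _.
  by rewrite mulr_sumr mulr_suml.
under [X in _ - X]eq_bigr do rewrite E1.
have -> : \E (fun w => dF (W w)) = (\sum_(i <- I) \sum_(j <- A i)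
    \E (fun w => zeta i w * zeta j w)) * \E (fun w => dF (W w)).
  by rewrite sum_E_zeta_eta mul1r.
rewrite mulr_suml -sumrB.
rewrite (le_trans (ler_norm_sum _ _ _))// mulr_sumr big_seq [leRHS]big_seq.
apply: ler_sum => i iI.
rewrite mulr_suml -sumrB (le_trans (ler_norm_sum _ _ _))// mulr_sumr big_seq [leRHS]big_seq.
apply: ler_sum => j jA.
set s := \E (fun w => zeta i w * zeta j w).
have := @indep2 i j dF _ iI jA mdF bdF; rewrite -/s => H.
have iW : integrableR P (fun w => dF (W w)) by exact: (@ordS_integrable 1).
have iWt := @ordS_integrable 1 _ isT (odFWt i).
have izzdt : integrableR P (fun w => zeta i w * zeta j w * dF (W w - tau i w)).
  exact: (@ordS_integrable 3 _ isT (@ordSM 2 1 _ _ (ozz i j) (odFWt i))).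
have otn : ordS 1 (fun w => \sum_(k <- B i) `|zeta k w|).
  by apply: ordS_sum => k; exact: ordS_norm.
have dle w : `|dF (W w) - dF (W w - tau i w)| <= 2 * \sum_(k <- B i) `|zeta k w|.
  rewrite (le_trans (dstein_lipschitz lg cg _ _))//.
  by rewrite subKr ler_wpM2l// ler_norm_sum.
have T1 : `|\E (fun w => dF (W w)) - \E (fun w => dF (W w - tau i w))| <=
    2 * \sum_(k <- B i) \E (fun w => `|zeta k w|).
  rewrite -expB// -exp_sum; last first.
    by move=> k; apply: (@ordS_integrable 1) => //; exact: ordS_norm.
  rewrite -expZ; last exact: (@ordS_integrable 1).
  apply: exp_norm_le => //.
    exact: (@ordS_integrable 1 _ isT (ordSB odFW (odFWt i))).
  by apply: integrableRZ; exact: (@ordS_integrable 1).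
have T2 : `|\E (fun w => zeta i w * zeta j w * dF (W w)) -
      \E (fun w => zeta i w * zeta j w * dF (W w - tau i w))| <=
    2 * \sum_(k <- B i) \E (fun w => `|zeta i w * zeta j w * zeta k w|).
  have o3 k : ordS 3 (fun w => `|zeta i w * zeta j w * zeta k w|).
    by apply: ordS_norm; exact: (@ordSM 2 1).
  rewrite -expB// -exp_sum; last by move=> k; exact: (@ordS_integrable 3).
  rewrite -expZ; last by apply: (@ordS_integrable 3) => //; exact: ordS_sum.
  apply: exp_norm_le => //.
  - apply: (@ordS_integrable 3) => //; apply: ordSB; first exact: (@ordSM 2 1).
    exact: (@ordSM 2 1 _ _ (ozz i j) (odFWt i)).
  - by apply: integrableRZ; apply: (@ordS_integrable 3) => //; exact: ordS_sum.
  - move=> w; rewrite -mulrBr normrM.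
    rewrite (le_trans (ler_wpM2l (normr_ge0 _) (dle w)))//.
    rewrite mulrCA mulr_sumr ler_wpM2l//.
    by under [leRHS]eq_bigr do rewrite normrM.
have -> : s * \E (dF \o W) - \E (fun w => zeta i w * zeta j w * dF (W w)) =
  s * (\E (fun w => dF (W w)) - \E (fun w => dF (W w - tau i w))) -
  (\E (fun w => zeta i w * zeta j w * dF (W w)) -
      \E (fun w => zeta i w * zeta j w * dF (W w - tau i w))).
  by rewrite H; ring.
rewrite (le_trans (ler_normB _ _))// big_split/= [leRHS]mulrDr [leRHS]addrC lerD//.
rewrite normrM (le_trans (ler_wpM2l (normr_ge0 _) T1))//.
by rewrite mulrCA mulr_sumr.
Qed.

(** By the Stein equation the left side is [E (dF (W) - W F (W))], and both terms are close to the
    same sum of [E (zeta_i eta_i dF (W))]. *)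
Lemma stein_local_dependence : `|\E (fun w => g (W w))| <=
  2 * \sum_(i <- I) \sum_(j <- A i) \sum_(k <- B i)
     (\E (fun w => `|zeta i w * zeta j w * zeta k w|) +
      `|\E (fun w => zeta i w * zeta j w)| * \E (fun w => `|zeta k w|))
  + \sum_(i <- I) \E (fun w => `|zeta i w| * eta i w ^+ 2).
Proof.
have -> : \E (fun w => g (W w)) = \E (fun w => dF (W w)) - \E (fun w => W w * F (W w)).
  rewrite -expB; last 2 first.
  - exact: (@ordS_integrable 1).
  - by apply: (@ordS_integrable 2) => //; exact: (@ordSM 1 1).
  by apply: eq_Rintegral => w _; rewrite /dF /dstein -/F addrC addKr.
have := lerD E_dF E_WF; apply: le_trans.
rewrite -[X in _ <= _ + X]normrN (le_trans _ (ler_normD _ _))//.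
by rewrite opprB addrA subrK.
Qed.

End LocalDependence.

(** * Moment bounds *)

Section SumSquares.
Context {R : realType}.

Lemma sqr_sum_le (I : Type) (s : seq I) (a : I -> R) :
  (\sum_(i <- s) a i) ^+ 2 <= (size s)%:R * \sum_(i <- s) a i ^+ 2.
Proof.
have -> : (size s)%:R * \sum_(i <- s) a i ^+ 2 =
    \sum_(i <- s) \sum_(j <- s) (a i ^+ 2 + a j ^+ 2) / 2.
  under [RHS]eq_bigr => i _.
    rewrite -mulr_suml big_split/= big_const_seq count_predT iter_addr_0 mulrDl; over.
  rewrite big_split/= big_const_seq count_predT iter_addr_0 -mulr_suml sumrMnl.
  rewrite -mulr_natl -[X in _ = _ + X]mulr_natl; by field.
rewrite expr2 mulr_suml; apply: ler_sum => i _; rewrite mulr_sumr.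
apply: ler_sum => j _; have := sqr_ge0 (a i - a j); lra.
Qed.

End SumSquares.

Section Moments.
Context {d : measure_display} {T : measurableType d} {R : realType}.
Variable P : probability T R.
Local Notation "\E f" := (Rintegral P setT f) (at level 10, f at level 8).

Section CauchySchwarz.
Variables f g : T -> R.
Hypothesis mf : measurable_fun setT f.
Hypothesis mg : measurable_fun setT g.
Hypothesis if2 : integrableR P (fun w => f w ^+ 2).
Hypothesis ig2 : integrableR P (fun w => g w ^+ 2).

Lemma integrableR_mul : integrableR P (fun w => f w * g w).
Proof.
apply: (@integrableR_le _ _ _ _ _ (fun w => f w ^+ 2 + g w ^+ 2)).
- exact: measurable_funM.
- exact: integrableRD.
- move=> w; rewrite normrM -[f w ^+ 2]real_normK ?num_real//.
  rewrite -[g w ^+ 2]real_normK ?num_real//.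
  have := sqr_ge0 (`|f w| - `|g w|); have := sqr_ge0 (`|f w| + `|g w|); lra.
Qed.

Lemma exp_cauchy_schwarz :
  \E (fun w => `|f w * g w|) <=
  Num.sqrt (\E (fun w => f w ^+ 2)) * Num.sqrt (\E (fun w => g w ^+ 2)).
Proof.
set a := \E (fun w => f w ^+ 2); set b := \E (fun w => g w ^+ 2).
set c := \E (fun w => `|f w * g w|).
have a0 : 0 <= a by apply: exp_ge0 => w; exact: sqr_ge0.
have b0 : 0 <= b by apply: exp_ge0 => w; exact: sqr_ge0.
have c0 : 0 <= c by apply: exp_ge0.
have ic : integrableR P (fun w => `|f w * g w|) by exact/integrableR_norm/integrableR_mul.
(* Expectation of [(|f| - t |g|)^2 >= 0]; the best choice is [t = c / b]. *)
have H t : 2 * t * c <= a + t ^+ 2 * b.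
  have -> : 2 * t * c = \E (fun w => 2 * t * `|f w * g w|) by rewrite expZ.
  have -> : a + t ^+ 2 * b = \E (fun w => f w ^+ 2 + t ^+ 2 * g w ^+ 2).
    by rewrite expD ?expZ//; exact: integrableRZ.
  apply: exp_le; [exact: integrableRZ|by apply: integrableRD => //; exact: integrableRZ|].
  move=> w; rewrite normrM -[f w ^+ 2]real_normK ?num_real//.
  rewrite -[g w ^+ 2]real_normK ?num_real//.
  have := sqr_ge0 (`|f w| - t * `|g w|); lra.
rewrite -sqrtrM// -(ler_pXn2r (n := 2)) ?nnegrE ?sqrtr_ge0// sqr_sqrtr ?mulr_ge0//.
have [b00|bn0] := eqVneq b 0.
  rewrite b00 mulr0; have [->|cn0] := eqVneq c 0; first by rewrite expr0n.
  (* With [b = 0] the inequality is linear in [t], and this [t] would give [2 (a + 1) <= a]. *)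
  have := H ((a + 1) / c); rewrite b00 mulr0 addr0.
  rewrite mulrA divfK//; lra.
have := H (c / b).
have b1 : 0 < b by rewrite lt_def bn0.
rewrite -(ler_pM2r b1).
have -> : 2 * (c / b) * c * b = 2 * c ^+ 2 by field.
have -> : (a + (c / b) ^+ 2 * b) * b = a * b + c ^+ 2 by field.
lra.
Qed.

End CauchySchwarz.

Variable (zeta : nat -> T -> R).
Hypothesis mz : forall i, measurable_fun setT (zeta i).
Hypothesis iz4 : forall i, integrableR P (fun w => zeta i w ^+ 4).

Let m2 i := \E (fun w => zeta i w ^+ 2).
Let m4 i := \E (fun w => zeta i w ^+ 4).

Let m2_ge0 i : 0 <= m2 i. Proof. by apply: exp_ge0 => w; exact: sqr_ge0. Qed.
Let m4_ge0 i : 0 <= m4 i.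
Proof. by apply: exp_ge0 => w; rewrite exprn_even_ge0. Qed.

Let E4 i : (fun w => zeta i w ^+ 4) = (fun w => (zeta i w ^+ 2) ^+ 2).
Proof. by apply/funext => w; rewrite -exprM. Qed.

Let iz22 i : integrableR P (fun w => (zeta i w ^+ 2) ^+ 2).
Proof. by rewrite -E4. Qed.

Let mz2 i : measurable_fun setT (fun w => zeta i w ^+ 2).
Proof. exact: measurable_funX. Qed.

Lemma integrableR_sqr i : integrableR P (fun w => zeta i w ^+ 2).
Proof.
have := @integrableR_mul _ (fun=> 1) (mz2 i) (measurable_cst _) (iz22 i).
have -> : (fun w => zeta i w ^+ 2 * 1) = (fun w => zeta i w ^+ 2).
  by apply/funext => w; rewrite mulr1.
by apply; have := integrableR_cst P (1 ^+ 2).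
Qed.

Lemma exp_sqr_le i : m2 i <= Num.sqrt (m4 i).
Proof.
have := @exp_cauchy_schwarz _ (fun=> 1) (mz2 i) (measurable_cst _) (iz22 i).
move=> /(_ (integrableR_cst P (1 ^+ 2))).
rewrite exp_cst expr1n sqrtr1 mulr1 /m4 E4; apply: le_trans.
by under [leRHS]eq_Rintegral do rewrite mulr1 ger0_norm ?sqr_ge0//.
Qed.

Lemma exp_mul2_sqr_le i j :
  integrableR P (fun w => (zeta i w * zeta j w) ^+ 2) /\
  \E (fun w => (zeta i w * zeta j w) ^+ 2) <= Num.sqrt (m4 i) * Num.sqrt (m4 j).
Proof.
have E : (fun w => (zeta i w * zeta j w) ^+ 2) = (fun w => zeta i w ^+ 2 * zeta j w ^+ 2).
  by apply/funext => w; rewrite exprMn.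
rewrite E; split; first exact: integrableR_mul.
rewrite /m4 !E4; have := exp_cauchy_schwarz (mz2 i) (mz2 j) (iz22 i) (iz22 j).
apply: le_trans; rewrite le_eqVlt; apply/orP; left; apply/eqP.
by apply: eq_Rintegral => w _; rewrite [RHS]ger0_norm// mulr_ge0 ?sqr_ge0.
Qed.

Lemma exp_norm_mul2_le i j :
  \E (fun w => `|zeta i w * zeta j w|) <= Num.sqrt (m2 i) * Num.sqrt (m2 j).
Proof. by apply: exp_cauchy_schwarz => //; exact: integrableR_sqr. Qed.

Lemma exp_norm_le_sqrt i : \E (fun w => `|zeta i w|) <= Num.sqrt (m2 i).
Proof.
have := @exp_cauchy_schwarz _ (fun=> 1) (mz i) (measurable_cst _) (integrableR_sqr i).
move=> /(_ (integrableR_cst P (1 ^+ 2))).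
rewrite exp_cst expr1n sqrtr1 mulr1; apply: le_trans.
by under [leRHS]eq_Rintegral do rewrite mulr1.
Qed.

(** Cauchy-Schwarz separates [zeta_k] from the pair, then splits the second moment of the pair; the
    exponent [1 / 4] is treated as a square root of a square root. *)
Lemma exp_norm_mul3_le i j k :
  \E (fun w => `|zeta i w * zeta j w * zeta k w|) <=
  (m4 i * m4 j * m4 k) `^ (1 / 4).
Proof.
have [i2 le2] := exp_mul2_sqr_le i j.
have := @exp_cauchy_schwarz (fun w => zeta i w * zeta j w) (zeta k)
  (measurable_funM (mz i) (mz j)) (mz k) i2 (integrableR_sqr k).
move/le_trans; apply.
have -> : (1 / 4 : R) = 2^-1 * 2^-1 by field.
rewrite powRrM !powR12_sqrt ?sqrtr_ge0 ?mulr_ge0//.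
rewrite sqrtrM ?mulr_ge0// [leRHS]sqrtrM ?sqrtr_ge0//.
apply: ler_pM; rewrite ?sqrtr_ge0//; apply: ler_wsqrtr => //.
  by rewrite sqrtrM.
exact: exp_sqr_le.
Qed.

Lemma exp_norm_sqr_le i j :
  \E (fun w => `|zeta i w| * zeta j w ^+ 2) <= (m2 i * m4 j) `^ (1 / 2).
Proof.
have := @exp_cauchy_schwarz _ _ (mz i) (mz2 j) (integrableR_sqr i) (iz22 j).
rewrite -E4 -/(m2 i) -/(m4 j) div1r powR12_sqrt ?mulr_ge0// sqrtrM//.
apply: le_trans; rewrite le_eqVlt; apply/orP; left; apply/eqP.
by apply: eq_Rintegral => w _; rewrite normrM [X in _ = _ * X]ger0_norm ?sqr_ge0.
Qed.

Lemma exp_norm_sqr_sum_le (s : seq nat) i :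
  \E (fun w => `|zeta i w| * (\sum_(j <- s) zeta j w) ^+ 2) <=
  (size s)%:R * \sum_(j <- s) (m2 i * m4 j) `^ (1 / 2).
Proof.
have ij j : integrableR P (fun w => `|zeta i w| * zeta j w ^+ 2).
  apply: integrableR_mul => //; first exact: measurableT_comp.
  have := integrableR_sqr i; congr integrableR; apply/funext => w.
  by rewrite real_normK ?num_real.
have is_ : integrableR P (fun w => (size s)%:R * \sum_(j <- s) `|zeta i w| * zeta j w ^+ 2).
  by apply: integrableRZ; exact: integrableR_sum.
apply: (@le_trans _ _ (\E (fun w => (size s)%:R * \sum_(j <- s) `|zeta i w| * zeta j w ^+ 2))).
  have le_ w : `|zeta i w| * (\sum_(j <- s) zeta j w) ^+ 2 <=
      (size s)%:R * \sum_(j <- s) `|zeta i w| * zeta j w ^+ 2.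
    by rewrite -mulr_sumr [leRHS]mulrCA ler_wpM2l// sqr_sum_le.
  apply: exp_le => //; apply: integrableR_le is_ _ => //.
    apply: measurable_funM; first exact: measurableT_comp.
    by apply: measurable_funX; apply: measurable_sum.
  by move=> w; rewrite ger0_norm// mulr_ge0 ?sqr_ge0.
rewrite expZ ?exp_sum//; last exact: integrableR_sum.
by rewrite ler_wpM2l// ler_sum// => j _; exact: exp_norm_sqr_le.
Qed.

Lemma exp_mul2_norm_le i j k :
  `|\E (fun w => zeta i w * zeta j w)| * \E (fun w => `|zeta k w|) <=
  (m2 i * m2 j * m2 k) `^ (1 / 2).
Proof.
rewrite div1r powR12_sqrt ?mulr_ge0// sqrtrM ?mulr_ge0// sqrtrM//.
apply: ler_pM => //; [exact: exp_ge0| |exact: exp_norm_le_sqrt].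
apply: le_trans (exp_norm_mul2_le i j).
apply: le_normr_Rintegral => //; apply: integrableR_mul => //; exact: integrableR_sqr.
Qed.

(** Makes [1 + \sum |zeta_i|] an admissible envelope for the degree count. *)
Lemma integrableR_sum4 (I : seq nat) :
  integrableR P (fun w => (1 + \sum_(i <- I) `|zeta i w|) ^+ 4).
Proof.
set N : R := (size I)%:R.
apply: (@integrableR_le _ _ _ _ _ (fun w => 8 + 8 * N ^+ 3 * \sum_(i <- I) zeta i w ^+ 4)).
- apply: measurable_funX; apply: measurable_funD => //.
  by apply: measurable_sum => i; exact: measurableT_comp.
- apply: integrableRD; first exact: integrableR_cst.
  by apply: integrableRZ; exact: integrableR_sum.
- move=> w; rewrite ger0_norm ?exprn_even_ge0//.
  set t := \sum_(i <- I) `|zeta i w|.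
  have t0 : 0 <= t by apply: sumr_ge0.
  have s2 : t ^+ 2 <= N * \sum_(i <- I) `|zeta i w| ^+ 2 by exact: sqr_sum_le.
  have s4 : (\sum_(i <- I) `|zeta i w| ^+ 2) ^+ 2 <= N * \sum_(i <- I) (`|zeta i w| ^+ 2) ^+ 2.
    exact: sqr_sum_le.
  have t4 : t ^+ 4 <= N ^+ 3 * \sum_(i <- I) zeta i w ^+ 4.
    have -> : t ^+ 4 = (t ^+ 2) ^+ 2 by rewrite -exprM.
    apply: (@le_trans _ _ ((N * \sum_(i <- I) `|zeta i w| ^+ 2) ^+ 2)).
      by rewrite lerXn2r ?nnegrE ?sqr_ge0// mulr_ge0// sumr_ge0// => i _; exact: sqr_ge0.
    rewrite exprMn [leRHS](_ : _ = N ^+ 2 * (N * \sum_(i <- I) (`|zeta i w| ^+ 2) ^+ 2)).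
      by rewrite ler_wpM2l ?sqr_ge0.
    rewrite mulrA -exprSr; congr (_ * _); apply: eq_bigr => i _.
    by rewrite real_normK ?num_real// -exprM.
  have : (1 + t) ^+ 4 <= 8 + 8 * t ^+ 4.
    have := sqr_ge0 (t - 1); have := sqr_ge0 (t ^+ 2 - 1).
    (* This product is exactly [8 + 8 t^4 - (1 + t)^4]. *)
    have : 0 <= (t - 1) ^+ 2 * (7 * t ^+ 2 + 10 * t + 7).
      rewrite mulr_ge0 ?sqr_ge0// !addr_ge0 ?mulr_ge0 ?sqr_ge0//.
    lra.
  rewrite -mulrA; lra.
Qed.

End Moments.

(** * Independence of blocks *)

Lemma integral_pushforward_measurable d1 d2 (X : measurableType d1)
    (Y : measurableType d2) (R : realType) (phi : X -> Y)
    (mphi : measurable_fun setT phi) (mu : {measure set X -> \bar R})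
    (f : Y -> \bar R) : measurable_fun setT f ->
  (\int[pushforward mu phi]_y f y = \int[mu]_x f (phi x))%E.
Proof.
move=> mf; rewrite [LHS]integralE [RHS]integralE.
congr (_ - _)%E; rewrite ge0_integral_pushforward//.
- by rewrite preimage_setT; apply: eq_integral => x _; rewrite /= !funeposE.
- exact: measurable_funepos.
- by rewrite preimage_setT; apply: eq_integral => x _; rewrite /= !funenegE.
- exact: measurable_funeneg.
Qed.

Section Independence.
Context {d : measure_display} {T : measurableType d} {R : realType}.
Variable P : probability T R.
Local Notation "\E f" := (Rintegral P setT f) (at level 10, f at level 8).

Definition indep_rv {d1 d2} {T1 : measurableType d1} {T2 : measurableType d2}
    (U : T -> T1) (V : T -> T2) :=
  forall A B, measurable A -> measurable B ->
    P (U @^-1` A `&` V @^-1` B) = (P (U @^-1` A) * P (V @^-1` B))%E.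

Lemma indep_rv_cst {d1 d2} {T1 : measurableType d1} {T2 : measurableType d2}
    (c : T1) (V : T -> T2) : measurable_fun setT V -> indep_rv (cst c) V.
Proof.
move=> mV A B mA mB; rewrite preimage_cst; case: ifPn => _.
  by rewrite setTI probability_setT mul1e.
by rewrite set0I measure0 mul0e.
Qed.

(** The joint law and the product of the marginal laws agree on rectangles, hence everywhere, and
    Fubini applies. Integrability of every section ensures that the inner expectation is a genuine
    real number. *)
Lemma exp_indep {d1 d2} {T1 : measurableType d1} {T2 : measurableType d2}
    (U : T -> T1) (V : T -> T2) (F : T1 * T2 -> R) :
  measurable_fun setT U -> measurable_fun setT V -> indep_rv U V ->
  measurable_fun setT F -> integrableR P (fun w => F (U w, V w)) ->
  (forall y, integrableR P (fun w => F (U w, y))) ->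
  \E (fun w => F (U w, V w)) = \E (fun w' => \E (fun w => F (U w, V w'))).
Proof.
move=> mU mV UV mF iF iFy.
pose mU' := MeasurableFun.Pack (MeasurableFun.Class (isMeasurableFun.Build _ _ _ _ _ mU)).
pose mV' := MeasurableFun.Pack (MeasurableFun.Class (isMeasurableFun.Build _ _ _ _ _ mV)).
pose muU := distribution P mU'; pose muV := distribution P mV'.
have mUV : measurable_fun setT (fun w => (U w, V w)) by exact: measurable_fun_pair.
have mEF : measurable_fun setT (EFin \o F) by exact/measurable_EFinP.
have eqm : forall A, measurable A ->
    (muU \x muV)%E A = pushforward P (fun w => (U w, V w)) A.
  apply: product_measure_unique => A B mA mB.
  rewrite /pushforward -UV//; congr (P _).
have iprod : (muU \x muV)%E.-integrable setT (EFin \o F).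
  apply/integrableP; split => //.
  have /integrableP[_] := integrable_pushforward mUV mEF iF measurableT.
  apply: le_lt_trans; rewrite le_eqVlt; apply/orP; left; apply/eqP.
  by apply: eq_measure_integral => A mA _; exact: eqm.
rewrite /Rintegral; congr fine.
transitivity (\int[pushforward P (fun w => (U w, V w))]_x (F x)%:E)%E.
  by rewrite integral_pushforward_measurable.
transitivity (\int[muU \x muV]_x (F x)%:E)%E.
  by symmetry; apply: eq_measure_integral => A mA _; exact: eqm.
rewrite -integral21_prod_meas1//.
have mG := measurable_fubini_G iprod.
rewrite [LHS](integral_pushforward_measurable mV)//.
apply: eq_integral => w' _; rewrite -/(\E _) /Rintegral fineK; last first.
  exact: integrable_fin_num (iFy (V w')).
rewrite /fubini_G (integral_pushforward_measurable mU)//.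
by apply/measurable_EFinP; exact: measurable_fun_pair1.
Qed.

(* Two successive conditionings, first on [Z] and then on [U], give the joint
   independence of [V] and [(U, Z)]. *)
Lemma exp_indep_block (U V Z : T -> R) (phi : R -> R) :
  measurable_fun setT U -> measurable_fun setT V -> measurable_fun setT Z ->
  measurable_fun setT phi ->
  indep_rv U V -> indep_rv (fun w => (U w, V w)) Z ->
  integrableR P V -> (forall r, integrableR P (fun w => V w * phi (U w + r))) ->
  (forall r, integrableR P (fun w => phi (U w + r))) ->
  integrableR P (fun w => V w * phi (U w + Z w)) ->
  integrableR P (fun w => phi (U w + Z w)) ->
  \E (fun w => V w * phi (U w + Z w)) = \E V * \E (fun w => phi (U w + Z w)).
Proof.
move=> mU mV mZ mphi UV UVZ iV iVr ir iVZ iZ.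
have mUV : measurable_fun setT (fun w => (U w, V w)) by exact: measurable_fun_pair.
have mphiD : measurable_fun setT (fun x : (R * R) * R => phi (x.1.1 + x.2)).
  apply: measurableT_comp => //; apply: measurable_funD => //.
  by apply: measurableT_comp.
have step1 r : \E (fun w => V w * phi (U w + r)) = \E V * \E (fun w => phi (U w + r)).
  have mphir : measurable_fun setT (fun x : R * R => phi (x.1 + r)).
    by apply: measurableT_comp => //; apply: measurable_funD.
  have := @exp_indep _ _ _ _ U V (fun x => x.2 * phi (x.1 + r)) mU mV UV.
  move=> /(_ (measurable_funM measurable_snd mphir) (iVr r)) /= ->; last first.
    by move=> y; exact: integrableRZ.
  under eq_Rintegral => w' _ do rewrite expZ// mulrC.
  by rewrite expZ// mulrC.
rewrite (@exp_indep _ _ _ _ (fun w => (U w, V w)) Z (fun x => x.1.2 * phi (x.1.1 + x.2)))//=; last first.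
  by apply: measurable_funM => //; apply: measurableT_comp.
under eq_Rintegral => w' _ do rewrite step1 -expZ//.
rewrite -expZ//.
rewrite -[RHS](_ : \E (fun w => \E V * phi (U w + Z w)) = _)//.
rewrite [RHS](@exp_indep _ _ _ _ (fun w => (U w, V w)) Z (fun x => \E V * phi (x.1.1 + x.2)))//=.
- exact: measurable_funM.
- exact: integrableRZ.
- by move=> y; exact: integrableRZ.
Qed.

Variable X : nat -> {RV P >-> R}.

(** A copy of [T] with the sigma-algebra of the block [J]: being a function of the block becomes
    ordinary measurability on this type. *)
Definition sub_sigma (J : set nat) :=
  g_sigma_algebraType (\bigcup_(j in J) preimage_set_system setT (X j) measurable).

Lemma sub_sigma_measurable (J : set nat) (A : set T) :
  sigma_of X J A -> measurable A.
Proof.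
apply: smallest_sub; first exact: sigma_algebra_measurable.
move=> B [j _ [C mC <-]].
rewrite setTI -[_ @^-1` _]setTI; exact: measurable_funP.
Qed.

Lemma measurable_fun_sub_sigma (J : set nat) d' (T' : measurableType d') (f : T -> T') :
  measurable_fun setT (f : sub_sigma J -> T') -> measurable_fun setT f.
Proof.
move=> mf _ A mA; rewrite setTI; apply: (@sub_sigma_measurable J).
have := mf measurableT A mA; by rewrite setTI.
Qed.

Lemma measurable_RV_sub_sigma (J : set nat) j : J j ->
  measurable_fun setT (X j : sub_sigma J -> R).
Proof.
by move=> Jj _ A mA; apply: sub_sigma_algebra; exists j => //; exists A.
Qed.

Lemma measurable_fun_sub_sigmaW (J K : set nat) d' (T' : measurableType d') (f : T -> T') :
  J `<=` K ->
  measurable_fun setT (f : sub_sigma J -> T') -> measurable_fun setT (f : sub_sigma K -> T').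
Proof.
move=> JK mf _ A mA; have := mf measurableT A mA.
apply: sub_smallest2r; [exact: smallest_sigma_algebra|].
by move=> B [j Jj jB]; exists j; [exact: JK|exact: jB].
Qed.

Lemma m_dependent_indep m i d1 d2 (T1 : measurableType d1) (T2 : measurableType d2)
    (U : T -> T1) (V : T -> T2) : m_dependent X m -> (1 <= i)%N ->
  measurable_fun setT (U : sub_sigma [set j | (1 <= j <= i)%N] -> T1) ->
  measurable_fun setT (V : sub_sigma [set j | (i + m < j)%N] -> T2) ->
  indep_rv U V.
Proof.
move=> mdep i1 mU mV A B mA mB; apply: (mdep i) => //.
  by have := mU measurableT A mA; rewrite setTI.
by have := mV measurableT B mB; rewrite setTI.
Qed.

(* [V] lives on the block of indices [lo..hi], [U] at the left of it and [Z] at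
   its right, with gaps larger than [m]; [U] is constant when the left block
   is empty. *)
Lemma exp_m_dependent_block m a lo hi (U V Z : T -> R) (phi : R -> R) :
  m_dependent X m -> (1 <= lo)%N -> (1 <= hi)%N -> (a <= hi)%N ->
  measurable_fun setT phi ->
  ((exists c, U = cst c) \/ [/\ (1 <= a)%N, (a + m < lo)%N &
    measurable_fun setT (U : sub_sigma [set j | (1 <= j <= a)%N] -> R)]) ->
  measurable_fun setT (V : sub_sigma [set j | (lo <= j <= hi)%N] -> R) ->
  measurable_fun setT (Z : sub_sigma [set j | (hi + m < j)%N] -> R) ->
  integrableR P V -> (forall r, integrableR P (fun w => V w * phi (U w + r))) ->
  (forall r, integrableR P (fun w => phi (U w + r))) ->
  integrableR P (fun w => V w * phi (U w + Z w)) ->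
  integrableR P (fun w => phi (U w + Z w)) ->
  \E (fun w => V w * phi (U w + Z w)) = \E V * \E (fun w => phi (U w + Z w)).
Proof.
move=> mdep lo1 hi1 ahi mphi mU mV mZ.
(* Seen from [hi], both [U] and [V] belong to the past, so one application of m-dependence separates
   the pair from [Z]; another one at [a] separates [U] from [V]. *)
have mUhi : measurable_fun setT (U : sub_sigma [set j | (1 <= j <= hi)%N] -> R).
  case: mU => [[c ->]|[_ _]]; first exact: measurable_cst.
  apply: measurable_fun_sub_sigmaW => j /= /andP[-> /leq_trans]; exact.
have mVhi : measurable_fun setT (V : sub_sigma [set j | (1 <= j <= hi)%N] -> R).
  apply: measurable_fun_sub_sigmaW mV => j /= /andP[lj ->].
  by rewrite (leq_trans lo1 lj).
apply: exp_indep_block => //.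
- exact: measurable_fun_sub_sigma mUhi.
- exact: measurable_fun_sub_sigma mV.
- exact: measurable_fun_sub_sigma mZ.
- case: mU => [[c ->]|[a1 alo mU]].
    by apply: indep_rv_cst; exact: measurable_fun_sub_sigma mV.
  apply: (m_dependent_indep mdep a1) => //.
  apply: measurable_fun_sub_sigmaW mV => j /= /andP[lj _].
  exact: leq_trans lj.
- by apply: (m_dependent_indep mdep hi1) => //; exact: measurable_fun_pair.
Qed.

End Independence.

(** * Null sets and measurable versions *)

Section NullSets.
Context {d : measure_display} {T : measurableType d} {R : realType}.
Variables (mu : {measure set T -> \bar R}) (N : set T).
Hypothesis mN : measurable N.
Hypothesis N0 : mu N = 0%E.

Import HBNNSimple.

(* No measurability of the integrands is required: the integral of a
   nonnegative function is a supremum over simple functions below it. *)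
Let ge0_integral_null_le (f g : T -> \bar R) :
  (forall x, 0 <= f x)%E -> (forall x, 0 <= g x)%E ->
  (forall x, ~ N x -> f x = g x) -> (\int[mu]_x f x <= \int[mu]_x g x)%E.
Proof.
move=> f0 g0 fg; rewrite !ge0_integralTE//.
apply/ge_ereal_sup => _ /= [h hf <-].
have mNC : measurable (~` N) by exact: measurableC.
(* Cutting the simple function to zero on [N] places it below [g] without changing its integral. *)
apply: ereal_sup_ubound; exists (proj_nnsfun h mNC) => /=.
  move=> x; rewrite -[X in (X%:E <= _)%E]/(h x * \1_(~` N) x) indicE.
  have [Nx|Nx] := pselect (N x); last by rewrite mem_set// mulr1 -fg.
  by rewrite memNset ?mulr0//; apply.
have E (k : {nnsfun T >-> R}) : sintegral mu k = (\int[mu]_x (k x)%:E)%E.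
  by rewrite integral_nnsfun// patch_setT.
rewrite !E; apply: ae_eq_integral => //.
- by apply/measurable_EFinP; exact: measurable_funP.
- by apply/measurable_EFinP; exact: measurable_funP.
exists N; split => // x /= /not_implyP[_]; apply: contra_notP => Nx.
by rewrite -[X in X%:E = _]/(h x * \1_(~` N) x) indicE mem_set ?mulr1.
Qed.

Lemma eq_integral_null (f g : T -> \bar R) :
  (forall x, ~ N x -> f x = g x) -> (\int[mu]_x f x = \int[mu]_x g x)%E.
Proof.
move=> fg; rewrite [LHS]integralE [RHS]integralE; congr (_ - _)%E.
- apply/eqP; rewrite eq_le; apply/andP; split;
  by apply: ge0_integral_null_le => // x /fg e; rewrite !funeposE e.
- apply/eqP; rewrite eq_le; apply/andP; split;
  by apply: ge0_integral_null_le => // x /fg e; rewrite !funenegE e.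
Qed.

End NullSets.

Lemma eq_expectation_null d (T : measurableType d) (R : realType)
    (P : probability T R) (N : set T) (f g : T -> R) :
  measurable N -> P N = 0%E -> (forall x, ~ N x -> f x = g x) ->
  ('E_P[f] = 'E_P[g])%E.
Proof.
move=> mN N0 fg; rewrite unlock.
by apply: (eq_integral_null mN N0) => x /fg ->.
Qed.

(** * Measurable versions of parameter derivatives *)

Section MeasurableDerivative.
Context {R : realType}.

Lemma derive1_limn_esup (g : R -> R) (t : R) (h : nat -> R) :
  h @ \oo --> (0 : R) -> (forall k, h k != 0) -> derivable g t 1 ->
  limn_esup (fun k => ((h k)^-1 * (g (h k + t) - g t))%:E) = (derive1 g t)%:E.
Proof.
move=> h0 hn0 dg.
have hd : h @ \oo --> (0 : R)^'.
  move=> A dA; have /= := h0 _ dA.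
  by rewrite !nbhs_filterE /=; apply: filterS => k /=; apply; exact: hn0.
have dg1 : (fun h => h^-1 *: (g (h + t) - g t)) @ (0 : R)^' --> derive1 g t.
  rewrite derive1E; have := dg => /cvg_ex[l]; rewrite /derive => gl.
  have -> : (fun h : R => h^-1 *: (g (h + t) - g t)) = (fun h : R => h^-1 *: (g (h *: 1 + t) - g t)).
    by apply/funext => u; rewrite [u *: 1]mulr1.
  by rewrite (cvg_lim _ gl).
have cv : (fun k => ((h k)^-1 * (g (h k + t) - g t))%:E) @ \oo --> (derive1 g t)%:E.
  apply: cvg_EFin; first exact: nearW.
  exact: (cvg_comp _ _ hd dg1).
rewrite is_cvg_limn_esupE; last by apply/cvg_ex; exists (derive1 g t)%:E.
exact: cvg_lim cv.
Qed.

(** Only [t] and the countably many parameters [t + e / (k + 1)], kept in [Theta] by openness, are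
    involved, so versions can be chosen separately at each. The upper limit is measurable even where
    no derivative exists. *)
Lemma measurable_derive1_version d (T : measurableType d) (Theta : set R)
    (t : R) (S : set T) (G : T -> R -> R) :
  open Theta -> Theta t ->
  (forall u, Theta u ->
    exists2 g : T -> R, measurable_fun setT g & forall x, S x -> g x = G x u) ->
  (forall x, S x -> derivable (G x) t 1) ->
  exists2 g : T -> R, measurable_fun setT g & forall x, S x -> g x = derive1 (G x) t.
Proof.
move=> oT Tt Gm dG.
have [e e0 eT] : exists2 e : R, 0 < e & forall u, `|u| <= e -> Theta (u + t).
  have := oT t Tt => /nbhs_ballP[e /= e0 eT]; exists (e / 2); first by rewrite divr_gt0.
  move=> u ue; apply: eT; rewrite /ball/= opprD addrCA subrr addr0 normrN.
  by rewrite (le_lt_trans ue)// ltr_pdivrMr// ltr_pMr// ltr1n.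
pose h (k : nat) : R := e / k.+1%:R.
have hT k : Theta (h k + t).
  apply: eT; have := ltW e0 => e0'; rewrite /h ger0_norm ?divr_ge0// ler_pdivrMr//.
  by rewrite ler_peMr// ler1n.
have h0 : h @ \oo --> (0 : R).
  rewrite -[X in _ --> X](mulr0 e); apply: cvgM; first exact: cvg_cst.
  exact: cvg_harmonic.
pose gk k := sval (cid2 (Gm _ (hT k))); pose g0 := sval (cid2 (Gm _ Tt)).
exists (fun x => fine (limn_esup (fun k => ((h k)^-1 * (gk k x - g0 x))%:E))).
  apply: measurableT_comp => //.
  apply: measurable_fun_limn_esup => k; apply/measurable_EFinP.
  apply: measurable_funM => //; apply: measurable_funB.
    by rewrite /gk; case: cid2.
  by rewrite /g0; case: cid2.
move=> x Sx; have -> : (fun k => ((h k)^-1 * (gk k x - g0 x))%:E) =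
    (fun k => ((h k)^-1 * (G x (h k + t) - G x t))%:E).
  apply/funext => k; rewrite /gk /g0.
  by case: cid2 => g1 _ /= ->//; case: cid2 => g2 _ /= ->.
rewrite derive1_limn_esup//; last exact: dG.
by move=> k; rewrite /h mulf_neq0 ?invr_neq0// gt_eqF.
Qed.

End MeasurableDerivative.

(** * The likelihood *)

Section LikelihoodMeasurability.
Context {R : realType}.
Variables (m : nat) (f : nat -> seq R -> R -> R -> R).

Lemma rev_iota a k : rev (iota a k) = [seq (a + k - j)%N | j <- iota 1 k].
Proof.
apply: (@eq_from_nth _ 0%N); rewrite size_rev ?size_map !size_iota// => i ik.
rewrite nth_rev size_iota// (nth_map 0%N) ?size_iota// !nth_iota//; last by lia.
by lia.
Qed.

(** Listed backwards from time [i]: the head is the current observation and the tail is the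
    conditioning sequence in the order of [past]. *)
Definition window (Y : nat -> R) (i : nat) : (minn m i.-1).+1.-tuple R :=
  [tuple Y (i - j)%N | j < (minn m i.-1).+1].

Lemma windowE Y i : window Y i = [seq Y (i - j)%N | j <- iota 0 (minn m i.-1).+1] :> seq R.
Proof. by rewrite -val_enum_ord -map_comp. Qed.

Lemma cond_dens_window (x : seq R) Y i theta : (1 <= i)%N ->
  (forall j, (maxn (i - m) 1 <= j <= i)%N -> x`_j.-1 = Y j) ->
  cond_dens m f i x theta = f i (behead (window Y i)) (thead (window Y i)) theta.
Proof.
move=> i1 xY; rewrite /cond_dens /past /index_iota rev_iota -map_comp.
have -> : thead (window Y i) = Y i.
  by rewrite /thead tnth_mktuple subn0.
rewrite windowE /= -xY; last by lia.
have -> : (i - maxn (i - m) 1 = minn m i.-1)%N by lia.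
congr (f i _ _ theta); apply/eq_in_map => j; rewrite mem_iota => jm /=.
have -> : (maxn (i - m) 1 + minn m i.-1 - j = i - j)%N by lia.
by apply: xY; lia.
Qed.

(** The domain is abstract because two are needed: the tuples, for the likelihood, and [Omega] with
    the sigma-algebra of a block, for the scores. *)
Lemma measurable_cond_dens d (T : measurableType d) (x : T -> seq R)
    (Y : nat -> T -> R) i theta : (1 <= i)%N ->
  measurable_fun [set: (minn m i.-1).+1.-tuple R]
    (fun z : (minn m i.-1).+1.-tuple R => f i (behead z) (thead z) theta) ->
  (forall j, (maxn (i - m) 1 <= j <= i)%N -> measurable_fun setT (Y j)) ->
  (forall t j, (maxn (i - m) 1 <= j <= i)%N -> (x t)`_j.-1 = Y j t) ->
  measurable_fun setT (fun t => cond_dens m f i (x t) theta).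
Proof.
move=> i1 mf mY xY.
have -> : (fun t => cond_dens m f i (x t) theta) =
    (fun z : (minn m i.-1).+1.-tuple R => f i (behead z) (thead z) theta) \o
    (fun t => window (Y ^~ t) i).
  by apply/funext => t; rewrite (@cond_dens_window _ (Y ^~ t))// => j; exact: xY.
apply: measurableT_comp => //; apply/measurable_fun_tnthP => j.
have -> : (@tnth _ R)^~ j \o (fun t => window (Y^~ t) i) = Y (i - j)%N.
  by apply/funext => t /=; rewrite tnth_mktuple.
apply: mY; have := ltn_ord j; lia.
Qed.

Lemma measurable_tuple_nth n j : (j < n)%N ->
  measurable_fun [set: n.-tuple R] (fun x : n.-tuple R => x`_j).
Proof.
move=> jn; have -> : (fun x : n.-tuple R => x`_j) = (@tnth n R)^~ (Ordinal jn).
  by apply/funext => x; rewrite (tnth_nth 0).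
exact: measurable_tnth.
Qed.

Variables (nu : {measure set (measurableTypeR R) -> \bar R}).
Variables (Theta : set R) (Supp : forall k, set (k.-tuple R)).
Hypothesis cdens : conditional_densities m f nu Theta Supp.

Lemma measurable_lik n theta : Theta theta ->
  measurable_fun setT (fun x : n.-tuple R => lik m f x theta).
Proof.
move=> Tt; rewrite /lik.
apply: measurable_prod => i; rewrite mem_index_iota => /andP[i1 iN].
have [_ mf _] := cdens Tt.
apply: (@measurable_cond_dens _ (n.-tuple R) (fun x => x)
  (fun j (x : n.-tuple R) => x`_j.-1) i theta) => //; first exact: mf.
by move=> j jr; apply: measurable_tuple_nth; lia.
Qed.

Lemma cond_dens_ge0 i x theta : (1 <= i)%N -> Theta theta ->
  0 <= cond_dens m f i x theta.
Proof. by move=> i1 Tt; have [f0 _ _] := cdens Tt; exact: f0. Qed.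

Lemma lik_ge0 n (x : n.-tuple R) theta : Theta theta -> 0 <= lik m f x theta.
Proof.
move=> Tt; rewrite /lik big_seq prodr_ge0// => i; rewrite mem_index_iota => /andP[i1 _].
exact: cond_dens_ge0.
Qed.

Lemma cond_dens_gt0 n (x : n.-tuple R) i theta : Theta theta ->
  0 < lik m f x theta -> (1 <= i <= n)%N -> 0 < cond_dens m f i x theta.
Proof.
move=> Tt x0 iN; rewrite lt_def cond_dens_ge0//; last by case/andP: iN.
rewrite andbT; apply: contraTneq x0 => c0.
by rewrite -leNgt /lik (bigD1_seq i) ?mem_index_iota ?iota_uniq//= c0 mul0r.
Qed.

Lemma loglik_sum n (x : n.-tuple R) theta : Theta theta ->
  0 < lik m f x theta ->
  loglik m f x theta = \sum_(1 <= i < n.+1) log_cond_dens m f i x theta.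
Proof.
move=> Tt x0; rewrite /loglik /lik.
have H (s : seq nat) : {subset s <= index_iota 1 n.+1} ->
  ln (\prod_(i <- s) cond_dens m f i x theta) = \sum_(i <- s) log_cond_dens m f i x theta.
  elim: s => [_|i s IH sN]; first by rewrite !big_nil ln1.
  have c0 j : j \in i :: s -> 0 < cond_dens m f j x theta.
    by move=> /sN; rewrite mem_index_iota; exact: cond_dens_gt0.
  rewrite !big_cons lnM ?IH//.
  - by move=> j js; apply: sN; rewrite in_cons js orbT.
  - by rewrite posrE c0// mem_head.
  - by rewrite posrE big_seq prodr_gt0// => j js; rewrite c0// in_cons js orbT.
exact: H.
Qed.

Lemma iterated_integral0 n : iterated_integral nu (fun=> 0 : \bar R) (n := n) = 0%E.
Proof.
elim: n => [//|n IH] /=.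
by under eq_integral do rewrite IH; rewrite integral0.
Qed.

Hypothesis supp : common_support m f Theta Supp.

Lemma Supp_gt0 n (x : n.-tuple R) theta : Theta theta -> Supp x ->
  0 < lik m f x theta.
Proof. by move=> Tt; rewrite (supp n Tt). Qed.

Lemma measurable_Supp n theta : Theta theta -> measurable (@Supp n).
Proof.
move=> Tt; rewrite (supp n Tt).
rewrite (_ : [set x | _] = (fun x : n.-tuple R => lik m f x theta) @^-1` `]0, +oo[).
  rewrite -[_ @^-1` _]setTI; exact: (measurable_lik Tt).
by apply/seteqP; split => x /=; rewrite in_itv/= andbT.
Qed.

Section sample.
Context {d : measure_display} {Omega : measurableType d}.
Variables (P : probability Omega R) (X : nat -> {RV P >-> R}).

Lemma measurable_sample n : measurable_fun setT (sample X n).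
Proof.
apply/measurable_fun_tnthP => i.
have -> : (@tnth n R)^~ i \o sample X n = X i.+1.
  by apply/funext => w /=; rewrite tnth_mktuple.
exact: measurable_funP.
Qed.

Lemma sample_nth n w j : (1 <= j <= n)%N -> (sample X n w)`_j.-1 = X j w.
Proof.
move=> /andP[j1 jn]; have jn' : (j.-1 < n)%N by lia.
rewrite -(tnth_nth 0 (sample X n w) (Ordinal jn')) tnth_mktuple /=.
by rewrite prednK.
Qed.

(** Off the support the likelihood is nonnegative but not positive, hence zero, so the integrand
    vanishes identically. *)
Lemma not_Supp_null n theta : Theta theta ->
  has_joint_density nu P (sample X n) (fun x => lik m f x theta) ->
  P (sample X n @^-1` (~` @Supp n)) = 0%E.
Proof.
move=> Tt ->; last by apply: measurableC; exact: measurable_Supp Tt.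
rewrite -[RHS](iterated_integral0 n); congr iterated_integral.
apply/funext => x; rewrite indicE; have [xS|xS] := pselect (Supp x).
  by rewrite memNset ?mul0r//; apply.
rewrite mem_set// mul1r; congr EFin; apply/eqP; rewrite eq_le lik_ge0// andbT.
by rewrite leNgt; apply/negP => x0; apply: xS; rewrite (supp n Tt).
Qed.

End sample.

End LikelihoodMeasurability.

(** * Stein's bound for m-dependent sums *)

Lemma measurable_sum_seq d (T : measurableType d) (R : realType) (I : eqType)
    (s : seq I) (f : I -> T -> R) :
  (forall i, i \in s -> measurable_fun setT (f i)) ->
  measurable_fun setT (fun w => \sum_(i <- s) f i w).
Proof.
move=> mf; have -> : (fun w => \sum_(i <- s) f i w) =
    (fun w => \sum_(i <- s) (if i \in s then f i else cst 0) w).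
  by apply/funext => w; apply: eq_big_seq => i ->.
by apply: measurable_sum => i; case: ifPn => // /mf.
Qed.

Section SteinMDependent.
Context {d : measure_display} {T : measurableType d} {R : realType}.
Variables (P : probability T R) (X : nat -> {RV P >-> R}) (m n : nat).
Local Notation "\E f" := (Rintegral P setT f) (at level 10, f at level 8).
Hypothesis mdep : m_dependent X m.
Variable zeta : nat -> T -> R.
Hypothesis szeta : forall i,
  measurable_fun setT (zeta i : sub_sigma X [set j | (maxn (i - m) 1 <= j <= i)%N] -> R).
Hypothesis iz4 : forall i, integrableR P (fun w => zeta i w ^+ 4).
Hypothesis zeta_out : forall i w, ~~ (1 <= i <= n)%N -> zeta i w = 0.
Hypothesis zeta0 : forall i, \E (zeta i) = 0.

Let I := index_iota 1 n.+1.
Let W w := \sum_(i <- I) zeta i w.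
Hypothesis W1 : \E (fun w => W w ^+ 2) = 1.

Let mzeta i : measurable_fun setT (zeta i).
Proof. exact: measurable_fun_sub_sigma (@szeta i). Qed.

Let S w := 1 + \sum_(i <- I) `|zeta i w|.

Let S1 w : 1 <= S w. Proof. by rewrite lerDl sumr_ge0. Qed.

Let iS4 : integrableR P (fun w => S w ^+ 4).
Proof. exact: (integrableR_sum4 mzeta iz4 I). Qed.

Let ozeta i : ordS S 1 (zeta i).
Proof.
split; first exact: mzeta.
exists 1; split=> // w; rewrite mul1r expr1.
have [iI|iI] := boolP (1 <= i <= n)%N; last first.
  by rewrite zeta_out// normr0 (le_trans ler01).
rewrite /S (bigD1_seq i) ?iota_uniq//=; last by rewrite mem_index_iota.
by rewrite addrCA lerDl addr_ge0// sumr_ge0.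
Qed.

Let left_block r i w := \sum_(1 <= k < maxn 1 (i - r)) zeta k w.
Let right_block r i w := \sum_((minn n (i + r)).+1 <= k < n.+1) zeta k w.

Let blockE r i w : (1 <= i <= n)%N ->
  W w - \sum_(j <- nbhd r n i) zeta j w = left_block r i w + right_block r i w.
Proof.
move=> iN; rewrite /W /I /nbhd /left_block /right_block.
rewrite (@big_cat_nat _ _ _ (maxn 1 (i - r)))/=; [|by lia|by lia].
rewrite (@big_cat_nat _ _ _ (minn n (i + r)).+1 (maxn 1 (i - r)))/=; [|by lia|by lia].
by rewrite [X in _ + X - _]addrC addrA addrK.
Qed.

(* The pairs [(r, s) = (2m, m), h = 0] and [(r, s) = (4m, 3m), h = 2m] give the
   two independence properties of Stein's method. *)
Let indep_block r s h i k (V : T -> R) (phi : R -> R) a :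
  (s + m <= r)%N -> (h + m + m <= r)%N -> (1 <= i <= n)%N -> (k <= 2)%N ->
  measurable_fun setT (V : sub_sigma X [set j | (maxn (i - s) 1 <= j <= i + h)%N] -> R) ->
  ordS S k V -> measurable_fun setT phi ->
  (forall x, `|phi x| <= a * (1 + `|x|)) ->
  \E (fun w => V w * phi (W w - \sum_(j <- nbhd r n i) zeta j w)) =
  \E V * \E (fun w => phi (W w - \sum_(j <- nbhd r n i) zeta j w)).
Proof.
move=> sr hr iN k2 mV oV mphi phia.
have E w : W w - \sum_(j <- nbhd r n i) zeta j w = left_block r i w + right_block r i w.
  exact: blockE.
under eq_Rintegral do rewrite E.
have -> : (fun w => phi (W w - \sum_(j <- nbhd r n i) zeta j w)) =
    (fun w => phi (left_block r i w + right_block r i w)).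
  by apply/funext => w; rewrite E.
have oU : ordS S 1 (left_block r i) by apply: (ordS_sum S1) => j; exact: ozeta.
have oZ : ordS S 1 (right_block r i) by apply: (ordS_sum S1) => j; exact: ozeta.
have ophir t : ordS S 1 (phi \o (fun w => left_block r i w + t)).
  by apply: ordS_comp phia => //; apply: ordSD => //; exact: ordS_cst.
have ophiZ : ordS S 1 (phi \o (fun w => left_block r i w + right_block r i w)).
  by apply: ordS_comp phia => //; exact: ordSD.
have int3 g : ordS S 1 g -> integrableR P (fun w => V w * g w).
  by move=> og; apply: (@ordS_integrable _ _ _ _ S _ _ (k + 1)) => //; [lia|exact: ordSM].
(* [(i - r).-1] is the last index in the left block; when [i - r <= 1] that block is empty and its
   sum is the constant 0. *)
apply: (@exp_m_dependent_block _ _ _ _ X m (i - r).-1 (maxn (i - s) 1) (i + h)) => //.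
- by lia.
- by lia.
- by lia.
- have [ir|ir] := leqP (i - r) 1.
    left; exists 0; apply/funext => w; rewrite /left_block big_geq//; lia.
  right; split; [by lia|by lia|].
  apply: measurable_sum_seq => j; rewrite mem_index_iota => jr.
  apply: measurable_fun_sub_sigmaW (@szeta j) => q /=; lia.
- apply: measurable_sum_seq => j; rewrite mem_index_iota => jr.
  apply: measurable_fun_sub_sigmaW (@szeta j) => q /=; lia.
- by apply: (@ordS_integrable _ _ _ _ S _ _ k) => //; lia.
- by move=> t; exact: int3 (ophir t).
- by move=> t; exact: (ordS_integrable S1 iS4 _ (ophir t)).
- exact: int3 ophiZ.
- exact: (ordS_integrable S1 iS4 _ ophiZ).
Qed.

Let m2 i := \E (fun w => zeta i w ^+ 2).
Let m4 i := \E (fun w => zeta i w ^+ 4).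
Let A := setA m n.
Let B := setB m n.

Lemma stein_m_dependent (h : R -> R) : lip1 h ->
  `|\E (fun w => h (W w)) - \int[lebesgue_measure]_t (h t * normal_pdf 0 1 t)| <=
  2 * (\sum_(i <- I) \sum_(j <- A i) \sum_(k <- B i) (m4 i * m4 j * m4 k) `^ (1 / 4)) +
  2 * (\sum_(i <- I) \sum_(j <- A i) \sum_(k <- B i) (m2 i * m2 j * m2 k) `^ (1 / 2)) +
  \sum_(i <- I) (size (A i))%:R * \sum_(j <- A i) (m2 i * m4 j) `^ (1 / 2).
Proof.
move=> lh; set Nh := \int[lebesgue_measure]_t _.
pose g x := h x - Nh.
have lg : lip1 g by exact: lip1B.
have cg : \int[lebesgue_measure]_t (g t * normal_pdf 0 1 t) = 0.
  under eq_Rintegral do rewrite mulrBl.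
  have ip := @integrable_std_normal_pdf R.
  rewrite RintegralB//=; last 2 first.
  - exact: integrable_lip1_std_normal_pdf.
  - have := @integrableZl _ _ _ lebesgue_measure setT measurableT Nh _ ip.
    by apply: eq_integrable.
  by rewrite RintegralZl// Rintegral_std_normal_pdf mulr1 subrr.
have oW : ordS S 1 W by apply: (ordS_sum S1) => j; exact: ozeta.
have -> : \E (fun w => h (W w)) - Nh = \E (fun w => g (W w)).
  rewrite /g expB; [by rewrite exp_cst| |exact: integrableR_cst].
  apply: (@ordS_integrable _ _ _ _ S _ _ 1 (h \o W)) => //.
  apply: (@ordS_comp _ _ _ S _ _ _ (`|h 0| + 1)) => //; first exact: lip1_measurable.
  move=> x; have := lip1_growth x lh; have := normr_ge0 x; have := normr_ge0 (h 0); nra.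
have := @stein_local_dependence _ _ _ P S S1 iS4 I A B zeta ozeta zeta0 W1 _ _ g lg cg.
move=> H; apply: le_trans (H _ _) _ => {H}.
- move=> i phi a; rewrite mem_index_iota => iN mphi phia.
  apply: (@indep_block (2 * m) m 0 i 1 _ _ a) => //; [by lia|by lia|].
  by rewrite addn0; exact: (@szeta i).
(* An index [j] of [A i] is at least [i - 2m], so the window of [zeta_j] starts no earlier than
   [i - 3m]; it ends at most at [i + 2m]. *)
- move=> i j phi a; rewrite mem_index_iota => iN jA mphi phia.
  apply: (@indep_block (4 * m) (3 * m) (2 * m) i 2 (fun w => zeta i w * zeta j w) _ a) => //; [by lia|by lia| |].
    move: jA; rewrite /A /setA /nbhd mem_index_iota => jA.
    apply: measurable_funM.
      by apply: measurable_fun_sub_sigmaW (@szeta i) => q /=; lia.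
    by apply: measurable_fun_sub_sigmaW (@szeta j) => q /=; lia.
  exact: (@ordSM _ _ _ S 1 1).
apply: lerD; last first.
  by apply: ler_sum => i _; exact: exp_norm_sqr_sum_le.
rewrite -mulrDr ler_wpM2l// -big_split/=; apply: ler_sum => i _.
rewrite -big_split/=; apply: ler_sum => j _.
rewrite -big_split/=; apply: ler_sum => k _.
by apply: lerD; [exact: exp_norm_mul3_le|exact: exp_mul2_norm_le].
Qed.

End SteinMDependent.

(** * The score at the maximum likelihood estimator *)

Section Calculus.
Context {R : realType}.

Lemma derivable_is_derive1 (g : R -> R) (t : R) : derivable g t 1 ->
  is_derive t 1 g (derive1 g t).
Proof. by move=> dg; rewrite derive1E; exact: derivableP. Qed.

Lemma is_derive_derive1 (g : R -> R) (t l : R) : is_derive t 1 g l ->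
  derive1 g t = l.
Proof. by move=> dg; rewrite derive1E derive_val. Qed.

Lemma is_derive_bigsum (s : seq nat) (h : nat -> R -> R) (dh : nat -> R) (t : R) :
  (forall i, i \in s -> is_derive t 1 (h i) (dh i)) ->
  is_derive t 1 (fun u => \sum_(i <- s) h i u) (\sum_(i <- s) dh i).
Proof.
elim: s => [_|i s IH H].
  have -> : (fun u => \sum_(i <- [::]) h i u) = cst 0.
    by apply/funext => u; rewrite big_nil.
  by rewrite big_nil; exact: is_derive_cst.
have -> : (fun u => \sum_(j <- i :: s) h j u) = h i + (fun u => \sum_(j <- s) h j u).
  by apply/funext => u; rewrite big_cons.
rewrite big_cons; apply: is_deriveD.
  by apply: H; rewrite mem_head.
by apply: IH => j js; apply: H; rewrite in_cons js orbT.
Qed.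

Lemma is_derive_lipschitz (g dg : R -> R) (a b K : R) :
  (forall z, Num.min a b <= z <= Num.max a b -> is_derive z 1 g (dg z)) ->
  (forall z, Num.min a b <= z <= Num.max a b -> `|dg z| <= K) ->
  `|g b - g a| <= K * `|b - a|.
Proof.
wlog ab : a b / a <= b => [H|].
  have [ab|ba] : a <= b \/ b <= a by apply/orP; exact: le_total.
    exact: H.
  move=> d1 d2; rewrite distrC [`|b - a|]distrC.
  by apply: H => // z; rewrite minC maxC; [exact: d1|exact: d2].
rewrite (min_idPl ab) (max_idPr ab) => dgz dgK.
have [c cab ->] := is_derive_MVT ab dgz.
by rewrite normrM ler_wpM2r// dgK.
Qed.

End Calculus.

Section LogLikelihood.
Context {R : realType}.
Variables (m : nat) (f : nat -> seq R -> R -> R -> R).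
Variables (nu : {measure set (measurableTypeR R) -> \bar R}).
Variables (Theta : set R) (Supp : forall k, set (k.-tuple R)).
Hypothesis oT : open Theta.
Hypothesis iT : is_interval Theta.
Hypothesis cdens : conditional_densities m f nu Theta Supp.
Hypothesis supp : common_support m f Theta Supp.
Variables (n : nat) (x : n.-tuple R).
Hypothesis xS : Supp x.
Local Notation l := (loglik m f x).

(** The logarithm of the product splits only at parameters of [Theta]; openness makes the identity
    hold near [t], which is enough to differentiate it. *)
Lemma derive1_loglik_sum t : Theta t ->
  (forall i, (1 <= i <= n)%N -> derivable (log_cond_dens m f i x) t 1) ->
  derive1 l t = \sum_(1 <= i < n.+1) derive1 (log_cond_dens m f i x) t.
Proof.
move=> Tt di; apply: is_derive_derive1.
apply: (@near_eq_is_derive _ _ _ (fun u => \sum_(1 <= i < n.+1) log_cond_dens m f i x u)).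
  have := open_nbhs_nbhs (conj oT Tt); apply: filterS => u Tu.
  by rewrite (loglik_sum cdens)//; exact: (Supp_gt0 supp).
apply: is_derive_bigsum => i; rewrite mem_index_iota => iN.
by apply: derivable_is_derive1; exact: di.
Qed.

Hypothesis d3 : three_times_derivable m f Theta (@Supp n).

Let dl k u : Theta u -> (k < 3)%N -> is_derive u 1 (derive1n k l) (derive1n k.+1 l u).
Proof. by move=> Tu k3; apply: derivable_is_derive1; exact: d3. Qed.

(** [Theta] is open, so a maximiser of the likelihood is an interior maximum of the
    log-likelihood. *)
Lemma derive1_loglik_argmax t : argmax_lik m f Theta x t -> derive1 l t = 0.
Proof.
move=> [Tt tmax]; have /nbhs_ballP[e /= e0 eT] := open_nbhs_nbhs (conj oT Tt).
apply: is_derive_derive1; apply: (@derive1_at_max _ _ (t - e) (t + e)).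
- by rewrite lerBlDr -addrA lerDl addr_ge0// ltW.
- move=> u; rewrite in_itv/= => /andP[u1 u2]; apply: (@d3 u x 0) => //.
  by apply: eT; rewrite /ball/= ltr_norml; apply/andP; split; lra.
- by rewrite in_itv/=; apply/andP; split; lra.
- move=> u; rewrite in_itv/= => /andP[u1 u2].
  have Tu : Theta u by apply: eT; rewrite /ball/= ltr_norml; apply/andP; split; lra.
  by rewrite /loglik ler_ln ?posrE ?(Supp_gt0 supp)//; exact: tmax.
Qed.

(** Expansion of [l'] from [theta0] to its zero [t]: the segment between them stays in the interval
    [Theta], and there [l''] is Lipschitz with constant [sd]. *)
Lemma score_taylor theta0 t sd : Theta theta0 -> argmax_lik m f Theta x t ->
  (forall u, Theta u -> `|derive1n 3 l u| <= sd) ->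
  `|derive1n 1 l theta0 + derive1n 2 l theta0 * (t - theta0)| <=
  sd / 2 * (t - theta0) ^+ 2.
Proof.
move=> T0 tmax l3; have Tt : Theta t by case: tmax.
have Tm a b z : Theta a -> Theta b -> Num.min a b <= z <= Num.max a b -> Theta z.
  move=> Ta Tb; case: (leP a b) => _; exact: iT.
have Tz s : 0 <= s <= 1 -> Theta (theta0 + s * (t - theta0)).
  move=> /andP[s0 s1]; apply: (Tm theta0 t) => //.
  by case: (leP theta0 t) => ?; apply/andP; split; nra.
have l't : derive1n 1 l t = 0 := derive1_loglik_argmax tmax.
have -> : derive1n 1 l theta0 + derive1n 2 l theta0 * (t - theta0) =
    - (derive1n 1 l t - derive1n 1 l theta0 - derive1n 2 l theta0 * (t - theta0)).
  by rewrite l't; ring.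
rewrite normrN; apply: is_derive_taylor_le => s s01; first exact: (dl (Tz s s01)).
rewrite -[X in _ <= sd * `|X|](addrK theta0) [s * _ + _]addrC.
apply: (@is_derive_lipschitz _ _ (derive1n 3 l)) => z zb.
  by apply: dl => //; exact: (Tm _ _ z T0 (Tz s s01) zb).
by apply: l3; exact: (Tm _ _ z T0 (Tz s s01) zb).
Qed.

End LogLikelihood.

(** * Finite variances, invariance under null sets, and the normal target *)

Section RandomVariables.
Context {d : measure_display} {T : measurableType d} {R : realType}.
Variable P : probability T R.
Local Notation "\E f" := (Rintegral P setT f) (at level 10, f at level 8).

Lemma expectationE (f : T -> R) : integrableR P f -> ('E_P[f] = (\E f)%:E)%E.
Proof. by move=> fi; rewrite unlock /Rintegral fineK//; exact: integrable_fin_num. Qed.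

Lemma ge0_expectation_integrableR (f : T -> R) : measurable_fun setT f ->
  (forall w, 0 <= f w) -> ('E_P[f] < +oo)%E -> integrableR P f.
Proof.
move=> mf f0; rewrite unlock => fi; apply/integrableP; split.
  exact/measurable_EFinP.
by under eq_integral do rewrite /= ger0_norm//.
Qed.

(** The centering constant [c] is [fine] of an expectation not yet known to be finite. The bound
    [Y^2 <= 2 (Y - c)^2 + 2 c^2] holds for any real [c]; it gives integrability, and only then is
    [c] identified as the mean. *)
Lemma variance_lty (Y : T -> R) : measurable_fun setT Y -> ('V_P[Y] < +oo)%E ->
  [/\ integrableR P Y, integrableR P (fun w => Y w ^+ 2),
    integrableR P (fun w => (Y w - \E Y) ^+ 2) &
    'V_P[Y] = (\E (fun w => (Y w - \E Y) ^+ 2))%:E].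
Proof.
move=> mY; rewrite /variance unlock; set c := fine 'E_P[Y] => VY.
have E : (Y \- cst c) * (Y \- cst c) = (fun w => (Y w - c) ^+ 2).
  by apply/funext => w; rewrite expr2.
rewrite E in VY *.
have i2 : integrableR P (fun w => (Y w - c) ^+ 2).
  apply: ge0_expectation_integrableR => //; last by move=> w; exact: sqr_ge0.
  by apply: measurable_funX; exact: measurable_funB.
have iY2 : integrableR P (fun w => Y w ^+ 2).
  apply: (@integrableR_le _ _ _ _ _ (fun w => 2 * (Y w - c) ^+ 2 + 2 * c ^+ 2)).
  - exact: measurable_funX.
  - by apply: integrableRD; [exact: integrableRZ|exact: integrableR_cst].
  - by move=> w; rewrite ger0_norm ?sqr_ge0//; have := sqr_ge0 (Y w - 2 * c); lra.
have iY : integrableR P Y.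
  have := @integrableR_mul _ _ _ P Y (fun=> 1) mY (measurable_cst _) iY2 (integrableR_cst P (1 ^+ 2)).
  by congr integrableR; apply/funext => w; rewrite mulr1.
have cE : c = \E Y by rewrite /c expectationE.
by rewrite -cE; split => //; rewrite expectationE.
Qed.

Lemma exp_sqr_center (Y : T -> R) a : integrableR P Y ->
  integrableR P (fun w => (Y w - \E Y) ^+ 2) ->
  integrableR P (fun w => (Y w - a) ^+ 2) /\
  \E (fun w => (Y w - a) ^+ 2) = \E (fun w => (Y w - \E Y) ^+ 2) + (\E Y - a) ^+ 2.
Proof.
set c := \E Y => iY i2.
have E : (fun w => (Y w - a) ^+ 2) =
    (fun w => ((Y w - c) ^+ 2 + (2 * (c - a)) * Y w) + (a ^+ 2 - c ^+ 2)).
  by apply/funext => w; ring.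
have i1 : integrableR P (fun w => (2 * (c - a)) * Y w) by exact: integrableRZ.
rewrite E; split.
  by apply: integrableRD; [exact: integrableRD|exact: integrableR_cst].
rewrite expD; [|exact: integrableRD|exact: integrableR_cst].
rewrite expD// expZ// exp_cst -/c; ring.
Qed.

Lemma expectation_null (N : set T) (f g : T -> R) : measurable N -> P N = 0%E ->
  (forall w, ~ N w -> f w = g w) -> \E f = \E g.
Proof.
by move=> mN N0 fg; rewrite /Rintegral (eq_integral_null mN N0 (g := EFin \o g))// => w /fg /= ->.
Qed.

Lemma variance_null (N : set T) (f g : T -> R) : measurable N -> P N = 0%E ->
  (forall w, ~ N w -> f w = g w) -> ('V_P[f] = 'V_P[g])%E.
Proof.
move=> mN N0 fg; rewrite /variance unlock (eq_expectation_null mN N0 fg).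
apply: (eq_expectation_null mN N0) => w /fg e.
by rewrite -[LHS]/((f w - _) * (f w - _)) e.
Qed.

Lemma expectation_std_normal (Z : {RV P >-> R}) (h : R -> R) : lip1 h ->
  distribution P Z = normal_prob 0 1 :> (set R -> \bar R) ->
  ('E_P[h \o Z] = (\int[lebesgue_measure]_t (h t * normal_pdf 0 1 t))%:E)%E.
Proof.
move=> lh ZN.
have mh : measurable_fun [set: measurableTypeR R] h by exact: lip1_measurable.
have ih := integrable_lip1_std_normal_pdf lh.
have iZ : (normal_prob 0 1).-integrable setT (EFin \o h).
  by apply: integrable_std_normal_prob => //; exact: lip1_measurable.
have mZ : measurable_fun setT (Z : T -> measurableTypeR R).
  have mZ0 : measurable_fun setT (Z : T -> R) by exact: measurable_funP.
  by move=> _ A mA; exact: (mZ0 measurableT A mA).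
rewrite unlock -Rintegral_std_normal_prob//.
rewrite /Rintegral fineK; last exact: integrable_fin_num.
transitivity (\int[pushforward P (Z : T -> measurableTypeR R)]_x (h x)%:E)%E.
  rewrite (integral_pushforward_measurable mZ)//.
  exact/measurable_EFinP.
apply: eq_measure_integral => A mA _.
by have := congr1 (fun F => F A) ZN => /= <-.
Qed.

End RandomVariables.

(** * Rescaling the bound *)

Section Scaling.
Context {R : realType}.
Implicit Types N a b c : R.

Let powR_exp_scale N x r s (k : nat) : 0 <= N -> 0 <= x -> k%:R * r = s ->
  (N ^+ k * x) `^ r = N `^ s * x `^ r.
Proof.
by move=> N0 x0 <-; rewrite powRM ?exprn_ge0// -powR_mulrn// -powRrM.
Qed.

(** As [xi_i = sqrt N * zeta_i], fourth moments carry [N^2]; three of them give [N^6], and the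
    exponent [1 / 4] leaves the power [3 / 2] of the prefactor. The next two lemmas reach it as a
    square root of [N^3]. *)
Lemma powR_scale4 N a b c : 0 <= N -> 0 <= a -> 0 <= b -> 0 <= c ->
  (N ^+ 2 * a * (N ^+ 2 * b) * (N ^+ 2 * c)) `^ (1 / 4) =
  N `^ (3 / 2) * (a * b * c) `^ (1 / 4).
Proof.
move=> N0 a0 b0 c0; rewrite -(@powR_exp_scale N _ _ (3 / 2) 6) ?mulr_ge0//.
  by congr (_ `^ _); ring.
by field.
Qed.

Lemma powR_scale2 N a b c : 0 <= N -> 0 <= a -> 0 <= b -> 0 <= c ->
  (N * a * (N * b) * (N * c)) `^ (1 / 2) = N `^ (3 / 2) * (a * b * c) `^ (1 / 2).
Proof.
move=> N0 a0 b0 c0; rewrite -(@powR_exp_scale N _ _ (3 / 2) 3) ?mulr_ge0//.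
  by congr (_ `^ _); ring.
by field.
Qed.

Lemma powR_scale24 N a b : 0 <= N -> 0 <= a -> 0 <= b ->
  (N * a * (N ^+ 2 * b)) `^ (1 / 2) = N `^ (3 / 2) * (a * b) `^ (1 / 2).
Proof.
move=> N0 a0 b0; rewrite -(@powR_exp_scale N _ _ (3 / 2) 3) ?mulr_ge0//.
  by congr (_ `^ _); ring.
by field.
Qed.

End Scaling.

(** * Sums and quotients of extended reals *)

Section EReal.
Context {R : realType}.
Local Open Scope ereal_scope.

Lemma sume_seq_EFin (s : seq nat) (F : nat -> \bar R) (G : nat -> R) :
  (forall i, i \in s -> F i = (G i)%:E) ->
  \sum_(i <- s) F i = (\sum_(i <- s) G i)%:E.
Proof. by move=> FG; rewrite -sumEFin; apply: eq_big_seq. Qed.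

Lemma sume_seq_pinfty (s : seq nat) (F : nat -> \bar R) i : i \in s ->
  (forall j, 0 <= F j) -> F i = +oo -> \sum_(j <- s) F j = +oo.
Proof.
move=> si F0 Fi; rewrite (big_rem i si)/= Fi addye//.
by rewrite gt_eqF// (lt_le_trans (ltNyr 0))// sume_ge0.
Qed.

(** With the inverse of 0 equal to [+oo] and that of [+oo] equal to 0, a degenerate or infinite
    variance would make the root infinite or zero. *)
Lemma sqrte_div_fin_num (x y : \bar R) : 0 < x -> 0 <= y ->
  sqrte (x / y) \is a fin_num -> sqrte (x / y) != 0 ->
  [/\ 0 < y, y < +oo & x < +oo].
Proof.
move=> x0 y0; have [->|yn0] := eqVneq y 0.
  by rewrite inve0 gt0_muley.
have y1 : 0 < y by rewrite lt_def yn0.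
have [->|yny] := eqVneq y +oo.
  by rewrite invey mule0 sqrte0 eqxx.
move=> fx _; split => //; first by rewrite ltey.
rewrite ltey; apply: contraTneq fx => ->.
case: y y0 yn0 y1 yny => [r| |]// r0 rn0 r1 _.
have r2 : (0 < r)%R by rewrite -lte_fin.
by rewrite inver gt_eqF// gt0_mulye// lte_fin invr_gt0.
Qed.

(** Covers both triple sums: [k = 2], [r = 1 / 4] for fourth moments and [k = 1], [r = 1 / 2] for
    second moments. *)
Lemma sume3_scale (s : seq nat) (A B : nat -> seq nat) (M : nat -> \bar R)
    (u : nat -> R) (N q r : R) (k : nat) : q != 0%R ->
  (forall i, i \in s -> {subset A i <= s}) ->
  (forall i, i \in s -> {subset B i <= s}) ->
  (forall i, 0 <= u i)%R -> (forall i, i \in s -> M i = (N ^+ k * u i)%:E) ->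
  (forall a b c, 0 <= a -> 0 <= b -> 0 <= c ->
    (N ^+ k * a * (N ^+ k * b) * (N ^+ k * c)) `^ r = q * (a * b * c) `^ r)%R ->
  (2 / q)%:E * \sum_(i <- s) \sum_(j <- A i) \sum_(l <- B i) (M i * M j * M l) `^ r =
  (2 * \sum_(i <- s) \sum_(j <- A i) \sum_(l <- B i) (u i * u j * u l) `^ r)%:E.
Proof.
move=> q0 As Bs u0 Mu scale.
have -> : \sum_(i <- s) \sum_(j <- A i) \sum_(l <- B i) (M i * M j * M l) `^ r =
    (q * \sum_(i <- s) \sum_(j <- A i) \sum_(l <- B i) (u i * u j * u l) `^ r)%:E.
  rewrite mulr_sumr; apply: sume_seq_EFin => i si.
  rewrite mulr_sumr; apply: sume_seq_EFin => j /(As i si) sj.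
  rewrite mulr_sumr; apply: sume_seq_EFin => l /(Bs i si) sl.
  by rewrite !Mu// -!EFinM poweR_EFin scale.
by rewrite -EFinM; congr EFin; field.
Qed.

Lemma sume2_scale (s : seq nat) (A : nat -> seq nat) (M2 M4 : nat -> \bar R)
    (u2 u4 : nat -> R) (N q r : R) : q != 0%R ->
  (forall i, i \in s -> {subset A i <= s}) ->
  (forall i, 0 <= u2 i)%R -> (forall i, 0 <= u4 i)%R ->
  (forall i, i \in s -> M2 i = (N * u2 i)%:E) ->
  (forall i, i \in s -> M4 i = (N ^+ 2 * u4 i)%:E) ->
  (forall a b, 0 <= a -> 0 <= b ->
    (N * a * (N ^+ 2 * b)) `^ r = q * (a * b) `^ r)%R ->
  (1 / q)%:E * \sum_(i <- s) ((size (A i))%:R%:E * \sum_(j <- A i) (M2 i * M4 j) `^ r) =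
  (\sum_(i <- s) (size (A i))%:R * \sum_(j <- A i) (u2 i * u4 j) `^ r)%:E.
Proof.
move=> q0 As u20 u40 Mu2 Mu4 scale.
have -> : \sum_(i <- s) ((size (A i))%:R%:E * \sum_(j <- A i) (M2 i * M4 j) `^ r) =
    (q * \sum_(i <- s) (size (A i))%:R * \sum_(j <- A i) (u2 i * u4 j) `^ r)%:E.
  rewrite mulr_sumr; apply: sume_seq_EFin => i si.
  rewrite mulrCA EFinM; congr (_ * _); rewrite mulr_sumr.
  apply: sume_seq_EFin => j /(As i si) sj.
  by rewrite Mu2// Mu4// -!EFinM poweR_EFin scale.
by rewrite -EFinM; congr EFin; field.
Qed.

End EReal.

Lemma mem_nbhd_self r n i : (1 <= i <= n)%N -> i \in nbhd r n i.
Proof. by move=> iN; rewrite mem_index_iota; lia. Qed.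

Lemma nbhd_sub r n i : {subset nbhd r n i <= index_iota 1 n.+1}.
Proof. by move=> j; rewrite !mem_index_iota; lia. Qed.

(** * Comparing expectations of Lipschitz functions *)

Section Comparison.
Context {d : measure_display} {T : measurableType d} {R : realType}.
Variable P : probability T R.
Local Notation "\E f" := (Rintegral P setT f) (at level 10, f at level 8).

Lemma integrableR_lip1 (h : R -> R) (U : T -> R) : lip1 h -> integrableR P U ->
  integrableR P (h \o U).
Proof.
move=> lh iU; apply: (@integrableR_le _ _ _ _ _ (fun w => `|h 0| + `|U w|)).
- apply: measurableT_comp; first exact: lip1_measurable.
  exact: integrableR_measurable iU.
- by apply: integrableRD; [exact: integrableR_cst|exact: integrableR_norm].
- by move=> w; exact: lip1_growth.
Qed.

(** The difference [h U - h V] is set to zero on [N], which changes no expectation and makes the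
    bound by [D] hold everywhere. *)
Lemma exp_lip1_le (h : R -> R) (U V D : T -> R) (N : set T) : lip1 h ->
  measurable N -> P N = 0%E ->
  integrableR P U -> integrableR P V -> integrableR P D -> (forall w, 0 <= D w) ->
  (forall w, ~ N w -> `|U w - V w| <= D w) ->
  `|\E (h \o U) - \E (h \o V)| <= \E D.
Proof.
move=> lh mN N0 iU iV iD D0 UVD.
have ihU := integrableR_lip1 lh iU; have ihV := integrableR_lip1 lh iV.
pose g w := (h (U w) - h (V w)) * \1_(~` N) w.
have gD w : `|g w| <= D w.
  rewrite /g indicE; have [Nw|Nw] := pselect (N w).
    by rewrite memNset ?mulr0 ?normr0//; apply.
  by rewrite mem_set// mulr1 (le_trans (lh _ _))// UVD.
rewrite -expB// (expectation_null (g := g) mN N0).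
  apply: exp_norm_le => //; apply: (integrableR_le _ iD gD).
  apply: measurable_funM.
    exact: measurable_funB (integrableR_measurable ihU) (integrableR_measurable ihV).
  by apply: measurable_indic; exact: measurableC.
by move=> w Nw; rewrite /g indicE mem_set// mulr1.
Qed.

Lemma integrableR_of_sqr (Y : T -> R) : measurable_fun setT Y ->
  integrableR P (fun w => Y w ^+ 2) -> integrableR P Y.
Proof.
move=> mY iY2.
have := @integrableR_mul _ _ _ P Y (fun=> 1) mY (measurable_cst _) iY2 (integrableR_cst P (1 ^+ 2)).
by congr integrableR; apply/funext => w; rewrite mulr1.
Qed.

Lemma exp_norm_le_sqrt_sqr (Y : T -> R) : measurable_fun setT Y ->
  integrableR P (fun w => Y w ^+ 2) ->
  \E (fun w => `|Y w|) <= Num.sqrt (\E (fun w => Y w ^+ 2)).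
Proof.
move=> mY iY2.
have := @exp_cauchy_schwarz _ _ _ P Y (fun=> 1) mY (measurable_cst _) iY2 (integrableR_cst P (1 ^+ 2)).
rewrite exp_cst expr1n sqrtr1 mulr1; apply: le_trans.
by under [leRHS]eq_Rintegral do rewrite mulr1.
Qed.

End Comparison.

Theorem theorem2p1 (R : realType)
  (d : measure_display) (Omega : measurableType d) (P : probability Omega R)
  (d' : measure_display) (Omega' : measurableType d')
  (P' : probability Omega' R) (Z : {RV P' >-> R})
  (nu : {measure set (measurableTypeR R) -> \bar R})
  (m n : nat) (X : nat -> {RV P >-> R})
  (f : nat -> seq R -> R -> R -> R)
  (Theta : set R) (theta0 : R) (Supp : forall k, set (k.-tuple R))
  (mle : forall k, k.-tuple R -> R) (i2 : R) :
  (* the model *)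
  (1 <= n)%N ->
  open Theta -> is_interval Theta -> Theta theta0 ->
  m_dependent X m -> identically_distributed X ->
  nu = lebesgue_measure \/ nu = counting ->
  conditional_densities m f nu Theta Supp ->
  common_support m f Theta Supp ->
  (forall k, (1 <= k)%N ->
    has_joint_density nu P (sample X k) (fun x => lik m f x theta0)) ->
  (* existence and uniqueness of the maximum likelihood estimator *)
  (forall k, (1 <= k)%N -> measurable_fun [set: k.-tuple R] (mle k)) ->
  (forall k, (1 <= k)%N ->
    {ae P, forall w,
      argmax_lik m f Theta (sample X k w) = [set mle k (sample X k w)]}) ->
  let thetahat k w : R := mle k (sample X k w) in
  let l' w : R := derive1n 1 (loglik m f (sample X n w)) theta0 in
  let l'' w : R := derive1n 2 (loglik m f (sample X n w)) theta0 in
  let score i w : R := derive1n 1 (log_cond_dens m f i (sample X n w)) theta0 in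
  let Sd : \bar R := sup_third m f Theta (Supp n) in
  (* A.D.1 *)
  three_times_derivable m f Theta (Supp n) -> (Sd < +oo)%E ->
  (* A.D.2 *)
  (forall i, (1 <= i <= n)%N ->
    (forall x, Supp n x -> derivable (log_cond_dens m f i x) theta0 1) /\
    ('E_P[score i] = 0)%E) ->
  (* A.D.3 *)
  (fun k => ((Num.sqrt k%:R)%:E * 'E_P[fun w => (thetahat k w - theta0)%R])%E)
    @ \oo --> 0%E ->
  (* A.D.4 *)
  (fun k => (1 / (k%:R%:E * 'V_P[thetahat k]))%E) @ \oo --> i2%:E ->
  0 < i2 ->
  (0 < 'V_P[l'])%E ->
  let alphaE : \bar R := sqrte ('V_P[l'] / 'V_P[thetahat n])%E in
  alphaE \is a fin_num -> alphaE != 0%E ->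
  let alpha : R := fine alphaE in
  let xi i w : R := score i w * Num.sqrt (n%:R / fine 'V_P[l']) in
  let M2 i : \bar R := 'E_P[fun w => (xi i w ^+ 2)%R]%E in
  let M4 i : \bar R := 'E_P[fun w => (xi i w ^+ 4)%R]%E in
  let mse : \bar R := 'E_P[fun w => ((thetahat n w - theta0) ^+ 2)%R]%E in
  let A := setA m n in
  let B := setB m n in
  let c : R := Num.sqrt (n%:R * i2) in
  let n32 : R := n%:R `^ (3 / 2) in
  distribution P' Z = normal_prob 0 1 :> (set R -> \bar R) ->
  (wasserstein P P' (fun w => (c * (thetahat n w - theta0))%R) Z <=
    (2 / n32)%:E *
      \sum_(1 <= i < n.+1) \sum_(j <- A i) \sum_(k <- B i)
        (M4 i * M4 j * M4 k) `^ (1 / 4)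
    + (2 / n32)%:E *
      \sum_(1 <= i < n.+1) \sum_(j <- A i) \sum_(k <- B i)
        (M2 i * M2 j * M2 k) `^ (1 / 2)
    + (1 / n32)%:E *
      \sum_(1 <= i < n.+1) ((size (A i))%:R%:E *
        \sum_(j <- A i) (M2 i * M4 j) `^ (1 / 2))
    + (`| Num.sqrt (n%:R * i2 * fine 'V_P[l']) / alpha - 1 |)%:E
    + Sd * (c / (2 * alpha))%:E * mse
    + (c / alpha)%:E * sqrte mse
      * sqrte 'E_P[fun w => ((l'' w + alpha) ^+ 2)%R])%E.
Proof.
move=> n1 oT iT T0 mdep _ _ cdens supp jd mmle mleu thetahat l' l'' score Sd d3 Sdoo AD2 _ _ i20.
move=> Vl0 alphaE alphafin alpha0 alpha xi M2 M4 mse A B c n32 ZN.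
(* Two exceptional events: off [N1] the sample lies in the support, which suffices for the
   derivatives; off the larger [N] the estimator is also the unique maximiser. *)
pose N1 := sample X n @^-1` (~` @Supp n).
have mN1 : measurable N1.
  rewrite -[N1]setTI; apply: measurable_sample => //.
  by apply: measurableC; exact: (@measurable_Supp _ _ _ _ _ _ cdens supp n _ T0).
have N10 : P N1 = 0%E := not_Supp_null cdens supp T0 (jd n n1).
have [N2 [mN2 N20 mleN2]] := mleu n n1.
pose N := N1 `|` N2.
have mN : measurable N by exact: measurableU.
have N0 : P N = 0%E by rewrite measureU0.
have suppN1 w : ~ N1 w -> Supp n (sample X n w).
  by move=> Nw; apply: contrapT => H; apply: Nw.
have suppN w : ~ N w -> Supp n (sample X n w).
  by move=> Nw; apply: suppN1 => H; apply: Nw; left.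
have mleN w : ~ N w -> argmax_lik m f Theta (sample X n w) (thetahat n w).
  move=> Nw; have -> : argmax_lik m f Theta (sample X n w) = [set thetahat n w].
    by apply: contrapT => H; apply: Nw; right; apply: mleN2.
  by [].
(* Each version is measurable for its own window, as m-dependence requires, and is zero for indices
   outside [1, ..., n], so that families indexed by all naturals can be used. *)
have sc_ex i : exists sc : Omega -> R,
    [/\ measurable_fun setT (sc : sub_sigma X [set j | (maxn (i - m) 1 <= j <= i)%N] -> R),
      (1 <= i <= n)%N -> forall w, ~ N1 w -> sc w = score i w &
      ~~ (1 <= i <= n)%N -> sc = cst 0].
  have [iN|iN] := boolP (1 <= i <= n)%N; last first.
    by exists (cst 0); split => //; exact: measurable_cst.
  have i1 : (1 <= i)%N by case/andP: iN.
  have [] := @measurable_derive1_version R _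
    (sub_sigma X [set j | (maxn (i - m) 1 <= j <= i)%N]) Theta theta0 (~` N1)
    (fun w => log_cond_dens m f i (sample X n w)) oT T0.
  - move=> u Tu; exists (fun w => log_cond_dens m f i (sample X n w) u) => //.
    apply: (@measurableT_comp _ _ _ _ _ _ (@ln R)); first exact: measurable_ln.
    apply: (@measurable_cond_dens R m f _
      (sub_sigma X [set j | (maxn (i - m) 1 <= j <= i)%N])
      (fun w => sample X n w : seq R) (fun j w => X j w) i u) => //.
    + by have [_ mf _] := cdens u Tu; exact: mf.
    + by move=> j jr; apply: measurable_RV_sub_sigma.
    + by move=> w j jr; rewrite sample_nth//; lia.
  - by move=> w Nw; apply: (AD2 i iN).1; exact: suppN1.
  - by move=> sc msc scE; exists sc; split.
have [sc scP] := choice sc_ex.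
(* The version lemma is nested: the inner use provides a version of [l'] at every parameter, the
   outer one differentiates at [theta0]. *)
have [l2 ml2 l2E] : exists2 l2 : Omega -> R, measurable_fun setT l2 & forall w, ~ N1 w -> l2 w = l'' w.
  apply: (@measurable_derive1_version R _ Omega Theta theta0 (~` N1)
    (fun w => derive1n 1 (loglik m f (sample X n w))) oT T0).
  - move=> u Tu; apply: (@measurable_derive1_version R _ Omega Theta u (~` N1)
      (fun w => loglik m f (sample X n w)) oT Tu).
    + move=> v Tv; exists (fun w => loglik m f (sample X n w) v) => //.
      apply: (@measurableT_comp _ _ _ _ _ _ (@ln R)); first exact: measurable_ln.
      apply: (measurableT_comp (measurable_lik cdens Tv)).
      exact: measurable_sample.
    + by move=> w Nw; apply: (@d3 u _ 0) => //; exact: suppN1.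
  - by move=> w Nw; apply: (@d3 theta0 _ 1) => //; exact: suppN1.
pose l1 w := \sum_(1 <= i < n.+1) sc i w.
have l1E w : ~ N1 w -> l' w = l1 w.
  move=> Nw; rewrite /l' -[derive1n 1 _]/(derive1 _).
  rewrite (derive1_loglik_sum oT cdens supp (suppN1 _ Nw) T0); last first.
    by move=> i iN; apply: (AD2 i iN).1; exact: suppN1.
  apply: eq_big_seq => i; rewrite mem_index_iota => iN.
  by have [_ ->] := scP i.
have mth : measurable_fun setT (thetahat n).
  by apply: measurableT_comp; [exact: mmle|exact: measurable_sample].
have msc i : measurable_fun setT (sc i).
  by have [ms _ _] := scP i; exact: measurable_fun_sub_sigma ms.
have ml1 : measurable_fun setT l1 by apply: measurable_sum.
have [VT0 VToo Vloo] := sqrte_div_fin_num Vl0 (variance_ge0 P (thetahat n)) alphafin alpha0.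
have alpha_gt0 : 0 < alpha.
  apply: fine_gt0; rewrite lt_def alpha0 sqrte_ge0/=.
  by rewrite -ge0_fin_numE ?sqrte_ge0.
have VlE : ('V_P[l'] = 'V_P[l1])%E := variance_null mN1 N10 l1E.
have [il1 il12 il1c] := variance_lty ml1 (eq_ind _ (fun v => (v < +oo)%E) Vloo _ VlE).
rewrite -VlE => VlR.
have [ith ith2 ithc VTR] := variance_lty mth VToo.
have [imse mseE] := exp_sqr_center theta0 ith ithc.
set Vl := Rintegral P setT (fun w => (l1 w - _) ^+ 2) in VlR.
have Vl_gt0 : 0 < Vl by rewrite -lte_fin -VlR.
have fVl : fine 'V_P[l']%E = Vl by rewrite VlR.
set mseR := Rintegral P setT _ in mseE.
(* Strict positivity ensures later that an infinite second moment of [l'' + alpha] makes the last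
   term of the bound infinite. *)
have mseR_gt0 : 0 < mseR.
  rewrite mseE; apply: ltr_wpDr; first exact: sqr_ge0.
  by rewrite -lte_fin -VTR.
have mse_R : mse = mseR%:E by rewrite /mse expectationE.
have c_gt0 : 0 < c by rewrite sqrtr_gt0 mulr_gt0// ltr0n.
have n_gt0 : 0 < n%:R :> R by rewrite ltr0n.
have n32_gt0 : 0 < n32 by rewrite powR_gt0.
(* A point of the support is needed for [0 <= Sd], since a supremum over the empty set is [-oo]. *)
have [x0 x0S] : exists x0, Supp n x0.
  apply: contrapT => noS; have : P N1 = 1%E.
    rewrite -(probability_setT P); congr (P _); apply/seteqP; split => // w _ Sw.
    by apply: noS; exists (sample X n w).
  by rewrite N10 => /eqP; rewrite eq_sym eqe oner_eq0.
have Sd_ub u x : Theta u -> Supp n x -> ((`|derive1n 3 (loglik m f x) u|)%:E <= Sd)%E.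
  by move=> Tu Sx; apply: ereal_sup_ubound; exists (u, x).
have Sd_ge0 : (0 <= Sd)%E.
  by apply: le_trans (Sd_ub _ _ T0 x0S); rewrite lee_fin.
have [sd sd0 SdE] : exists2 sd, 0 <= sd & Sd = sd%:E.
  by exists (fine Sd); rewrite ?fine_ge0// fineK// ge0_fin_numE.
have Eset0 (F : Omega -> R) k : (0 <= 'E_P[fun w => (F w ^+ (2 * k))%R])%E.
  by apply: expectation_ge0 => w; rewrite exprM exprn_ge0 ?sqr_ge0.
have M2_ge0 i : (0 <= M2 i)%E by exact: (Eset0 _ 1).
have M4_ge0 i : (0 <= M4 i)%E by exact: (Eset0 _ 2).
have T2_ge0 : (0 <= (2 / n32)%:E * \sum_(1 <= i < n.+1) \sum_(j <- A i) \sum_(k <- B i)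
        (M2 i * M2 j * M2 k) `^ (1 / 2))%E.
  apply: mule_ge0; first by rewrite lee_fin divr_ge0// ltW.
  by do 3 (apply: sume_ge0 => ? _); exact: poweR_ge0.
have T3_ge0 : (0 <= (1 / n32)%:E * \sum_(1 <= i < n.+1) ((size (A i))%:R%:E *
        \sum_(j <- A i) (M2 i * M4 j) `^ (1 / 2)))%E.
  apply: mule_ge0; first by rewrite lee_fin divr_ge0// ltW.
  apply: sume_ge0 => i _.
  by rewrite mule_ge0 ?lee_fin//; apply: sume_ge0 => j _; exact: poweR_ge0.
have T5_ge0 : (0 <= Sd * (c / (2 * alpha))%:E * mse)%E.
  by rewrite SdE mse_R !mule_ge0 ?lee_fin// ?divr_ge0 ?mulr_ge0 ?ltW.
have T6_ge0 : (0 <= (c / alpha)%:E * sqrte mse *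
    sqrte 'E_P[fun w => ((l'' w + alpha) ^+ 2)%R])%E.
  by rewrite !mule_ge0 ?sqrte_ge0// lee_fin divr_ge0 ?ltW.
have neqNy (x : \bar R) : (0 <= x)%E -> (x != -oo)%E.
  by move=> x0'; rewrite gt_eqF// (lt_le_trans (ltNyr 0)).
have [all4|/existsNP[i /not_implyP[iN /negP M4i]]] :=
    pselect (forall i, (1 <= i <= n)%N -> (M4 i < +oo)%E); last first.
  (* The diagonal term [j = k = i] of the first triple sum is then infinite; all other terms being
     different from [-oo], so is the right-hand side. *)
  have M4oo : M4 i = +oo%E by apply/eqP; rewrite -leye_eq leNgt.
  have iI : i \in index_iota 1 n.+1 by rewrite mem_index_iota.
  have inb r : i \in nbhd r n i by exact: mem_nbhd_self.
  have S3 : (\sum_(k <- B i) (M4 i * M4 i * M4 k) `^ (1 / 4) = +oo)%E.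
    apply: (sume_seq_pinfty (inb _)) => [j|]; first exact: poweR_ge0.
    by rewrite M4oo !mulyy poweRyr// gt_eqF// divr_gt0.
  have S2 : (\sum_(j <- A i) \sum_(k <- B i) (M4 i * M4 j * M4 k) `^ (1 / 4) = +oo)%E.
    apply: (sume_seq_pinfty (inb _)) => [j|//].
    by apply: sume_ge0 => k _; exact: poweR_ge0.
  have -> : (\sum_(1 <= i < n.+1) \sum_(j <- A i) \sum_(k <- B i)
        (M4 i * M4 j * M4 k) `^ (1 / 4) = +oo)%E.
    apply: (sume_seq_pinfty iI) => [j|//].
    by do 2 (apply: sume_ge0 => ? _); exact: poweR_ge0.
  rewrite gt0_muley ?lte_fin ?divr_gt0//.
  by rewrite !addye ?leey ?neqNy.
pose s := Num.sqrt Vl; have s_gt0 : 0 < s by rewrite sqrtr_gt0.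
have s2 : s ^+ 2 = Vl by rewrite sqr_sqrtr// ltW.
(* Normalised so that the sum has variance 1, while [xi i = sqrt n * zeta i] off [N1]. *)
pose zeta i w := sc i w / s.
have mz i : measurable_fun setT (zeta i) by apply: measurable_funM.
have sz i : measurable_fun setT (zeta i : sub_sigma X [set j | (maxn (i - m) 1 <= j <= i)%N] -> R).
  by have [ms _ _] := scP i; apply: measurable_funM.
have zeta_out i w : ~~ (1 <= i <= n)%N -> zeta i w = 0.
  by move=> iN; rewrite /zeta; have [_ _ ->//] := scP i; rewrite mul0r.
pose rn : R := Num.sqrt n%:R.
have rn_gt0 : 0 < rn by rewrite sqrtr_gt0.
have rn2 : rn ^+ 2 = n%:R by rewrite sqr_sqrtr// ltW.
have xiE i w : (1 <= i <= n)%N -> ~ N1 w -> xi i w = rn * zeta i w.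
  move=> iN Nw; have [_ scE _] := scP i.
  rewrite /xi fVl -(scE iN w Nw) sqrtrM ?(ltW n_gt0)// sqrtrV ?(ltW Vl_gt0)//.
  by rewrite -/rn -/s /zeta mulrCA.
have xi2 i w : (rn * zeta i w) ^+ 2 = n%:R * zeta i w ^+ 2 by rewrite exprMn rn2.
have xi4 i w : (rn * zeta i w) ^+ 4 = n%:R ^+ 2 * zeta i w ^+ 4.
  by rewrite exprMn -rn2 -exprM.
have M4e i : (1 <= i <= n)%N -> M4 i = 'E_P[fun w => (n%:R ^+ 2 * zeta i w ^+ 4)%R]%E.
  move=> iN; apply: (eq_expectation_null mN1 N10) => w Nw.
  by rewrite xiE// xi4.
have M2e i : (1 <= i <= n)%N -> M2 i = 'E_P[fun w => (n%:R * zeta i w ^+ 2)%R]%E.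
  move=> iN; apply: (eq_expectation_null mN1 N10) => w Nw.
  by rewrite xiE// xi2.
have n2_gt0 : 0 < n%:R ^+ 2 :> R by rewrite exprn_gt0.
have iz4 i : integrableR P (fun w => zeta i w ^+ 4).
  have [iN|iN] := boolP (1 <= i <= n)%N; last first.
    have := integrableR_cst P 0; congr integrableR; apply/funext => w.
    by rewrite zeta_out// expr0n.
  have i4 : integrableR P (fun w => n%:R ^+ 2 * zeta i w ^+ 4).
    apply: ge0_expectation_integrableR; last by rewrite -M4e//; exact: all4.
      by apply: measurable_funM => //; exact: measurable_funX.
    by move=> w; rewrite mulr_ge0 ?sqr_ge0// exprn_even_ge0.
  have := integrableRZ (n%:R ^+ 2)^-1 i4; congr integrableR; apply/funext => w.
  by rewrite mulKf// gt_eqF.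
have iz2 i := integrableR_sqr mz iz4 i.
have iz i := integrableR_of_sqr (mz i) (iz2 i).
pose m2 i := Rintegral P setT (fun w => zeta i w ^+ 2).
pose m4 i := Rintegral P setT (fun w => zeta i w ^+ 4).
have m2_ge0 i : 0 <= m2 i by apply: exp_ge0 => w; exact: sqr_ge0.
have m4_ge0 i : 0 <= m4 i by apply: exp_ge0 => w; rewrite exprn_even_ge0.
have M4E i : i \in index_iota 1 n.+1 -> M4 i = (n%:R ^+ 2 * m4 i)%:E.
  by rewrite mem_index_iota => iN; rewrite M4e// expectationE ?expZ//; exact: integrableRZ.
have M2E i : i \in index_iota 1 n.+1 -> M2 i = (n%:R * m2 i)%:E.
  by rewrite mem_index_iota => iN; rewrite M2e// expectationE ?expZ//; exact: integrableRZ.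
have scz i : sc i = (fun w => s * zeta i w).
  by apply/funext => w; rewrite /zeta mulrC divfK// gt_eqF.
have isc i : integrableR P (sc i) by rewrite scz; exact: integrableRZ.
have Ez i : Rintegral P setT (zeta i) = 0.
  have [iN|iN] := boolP (1 <= i <= n)%N; last first.
    by rewrite (_ : zeta i = cst 0) ?exp_cst//; apply/funext => w; exact: zeta_out.
  have [_ scE _] := scP i.
  have : ('E_P[sc i] = 0)%E.
    by rewrite -(AD2 i iN).2; apply: (eq_expectation_null mN1 N10) => w; exact: scE.
  rewrite expectationE// scz expZ// => /eqP.
  by rewrite eqe mulf_eq0 gt_eqF//= => /eqP.
have Esc i : Rintegral P setT (sc i) = 0 by rewrite scz expZ// Ez mulr0.
have El1 : Rintegral P setT l1 = 0 by rewrite exp_sum// big1.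
pose W w := \sum_(1 <= i < n.+1) zeta i w.
have Wl1 w : W w = l1 w / s by rewrite /W /l1 mulr_suml.
have mW : measurable_fun setT W by apply: measurable_sum.
have VlE2 : Vl = Rintegral P setT (fun w => l1 w ^+ 2).
  by apply: eq_Rintegral => w _; rewrite El1 subr0.
have W2 : (fun w => W w ^+ 2) = (fun w => Vl^-1 * l1 w ^+ 2).
  by apply/funext => w; rewrite Wl1 expr_div_n s2 mulrC.
have iW2 : integrableR P (fun w => W w ^+ 2) by rewrite W2; exact: integrableRZ.
have EW2 : Rintegral P setT (fun w => W w ^+ 2) = 1.
  by rewrite W2 expZ// -VlE2 mulVf// gt_eqF.
have iW := integrableR_of_sqr mW iW2.
have T1E := sume3_scale (s := index_iota 1 n.+1) (A := A) (B := B) (M := M4) (u := m4)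
  (N := n%:R) (q := n32) (r := 1 / 4) (k := 2) (lt0r_neq0 n32_gt0)
  (fun i _ => nbhd_sub (i := i)) (fun i _ => nbhd_sub (i := i)) m4_ge0 M4E
  (fun a b c' => powR_scale4 (ltW n_gt0)).
have T2E := sume3_scale (s := index_iota 1 n.+1) (A := A) (B := B) (M := M2) (u := m2)
  (N := n%:R) (q := n32) (r := 1 / 2) (k := 1) (lt0r_neq0 n32_gt0)
  (fun i _ => nbhd_sub (i := i)) (fun i _ => nbhd_sub (i := i)) m2_ge0 M2E
  (fun a b c' => powR_scale2 (ltW n_gt0)).
have T3E := sume2_scale (s := index_iota 1 n.+1) (A := A) (M2 := M2) (M4 := M4) (u2 := m2)
  (u4 := m4) (N := n%:R) (q := n32) (r := 1 / 2) (lt0r_neq0 n32_gt0)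
  (fun i _ => nbhd_sub (i := i)) m2_ge0 m4_ge0 M2E M4E
  (fun a b => powR_scale24 (ltW n_gt0)).
rewrite T1E T2E T3E {T1E T2E T3E}.
have -> : 'E_P[fun w => ((l'' w + alpha) ^+ 2)%R]%E = 'E_P[fun w => ((l2 w + alpha) ^+ 2)%R]%E.
  by apply: (eq_expectation_null mN1 N10) => w Nw; rewrite l2E.
have csE : Num.sqrt (n%:R * i2 * fine 'V_P[l']%E) = c * s.
  by rewrite fVl sqrtrM// mulr_ge0// ltW.
rewrite csE mse_R SdE.
have ml2a : measurable_fun setT (fun w => l2 w + alpha) by exact: measurable_funD.
have [E2oo|/negPf E2fin] := eqVneq 'E_P[fun w => ((l2 w + alpha) ^+ 2)%R]%E +oo%E.
  rewrite E2oo [sqrte +oo%E]/= gt0_muley; last first.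
    by rewrite -[sqrte _]/((Num.sqrt mseR)%:E) -EFinM lte_fin mulr_gt0 ?sqrtr_gt0// divr_gt0.
  by rewrite -!EFinM -!EFinD addey// leey.
have i2a : integrableR P (fun w => (l2 w + alpha) ^+ 2).
  apply: ge0_expectation_integrableR; last by rewrite ltey E2fin.
    exact: measurable_funX.
  by move=> w; exact: sqr_ge0.
rewrite expectationE//; set e2 := Rintegral P setT (fun w => (l2 w + alpha) ^+ 2).
rewrite -[sqrte mseR%:E]/((Num.sqrt mseR)%:E) -[sqrte e2%:E]/((Num.sqrt e2)%:E).
rewrite -!EFinM -!EFinD.
apply: ge_ereal_sup => _ /= [h lh <-].
pose Dl w := thetahat n w - theta0.
have mDl : measurable_fun setT Dl by exact: measurable_funB.
have iDl : integrableR P Dl by exact: integrableR_of_sqr mDl imse.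
pose X1 w := c * Dl w; pose X2 w := c * s / alpha * W w.
pose D1 w := c / alpha * (`|Dl w * (l2 w + alpha)| + sd / 2 * Dl w ^+ 2).
have iX1 : integrableR P X1 by exact: integrableRZ.
have iX2 : integrableR P X2 by exact: integrableRZ.
have iDl2 : integrableR P (fun w => `|Dl w * (l2 w + alpha)|).
  by apply: integrableR_norm; exact: integrableR_mul.
have isd : integrableR P (fun w => sd / 2 * Dl w ^+ 2) by exact: integrableRZ.
have ca_gt0 : 0 < c / alpha by rewrite divr_gt0.
have K1 : `|Rintegral P setT (h \o X1) - Rintegral P setT (h \o X2)| <= Rintegral P setT D1.
  apply: (exp_lip1_le lh mN N0) => //.
  - by apply: integrableRZ; exact: integrableRD.
  - by move=> w; rewrite mulr_ge0 ?(ltW ca_gt0)// addr_ge0// mulr_ge0 ?sqr_ge0// divr_ge0.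
  - move=> w Nw; have Nw1 : ~ N1 w by move=> H; apply: Nw; left.
    have tay := score_taylor (sd := sd) oT iT supp (suppN w Nw) d3 T0 (mleN w Nw).
    have {}tay : `|l1 w + l2 w * Dl w| <= sd / 2 * Dl w ^+ 2.
      rewrite -l1E// l2E//; apply: tay => u Tu.
      by rewrite -lee_fin -SdE; apply: Sd_ub => //; exact: suppN.
    (* Adding and subtracting [l2 w * Dl w] isolates the Taylor expression; the rest is the product
       to which Cauchy-Schwarz applies. *)
    have -> : X1 w - X2 w = c / alpha * (Dl w * (l2 w + alpha) - (l1 w + l2 w * Dl w)).
      by rewrite /X1 /X2 Wl1; field; rewrite !gt_eqF.
    rewrite normrM (gtr0_norm ca_gt0) ler_wpM2l ?(ltW ca_gt0)//.
    by rewrite (le_trans (ler_normB _ _))// lerD2l.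
have K1' : Rintegral P setT D1 <= c / alpha * (Num.sqrt mseR * Num.sqrt e2 + sd / 2 * mseR).
  rewrite expZ; last exact: integrableRD.
  rewrite ler_wpM2l ?(ltW ca_gt0)// expD// expZ// lerD2r.
  exact: (exp_cauchy_schwarz mDl ml2a imse i2a).
(* [X2] is a multiple of [W], and [E |W|] is at most the square root of [E (W^2) = 1]. *)
have K2 : `|Rintegral P setT (h \o X2) - Rintegral P setT (h \o W)| <= `|c * s / alpha - 1|.
  have iD2 : integrableR P (fun w => `|c * s / alpha - 1| * `|W w|).
    by apply: integrableRZ; exact: integrableR_norm.
  apply: le_trans (exp_lip1_le lh mN N0 iX2 iW iD2 _ _) _.
  - by move=> w; rewrite mulr_ge0.
  - by move=> w _; rewrite -[X in _ - X]mul1r -mulrBl normrM.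
  - rewrite expZ; last exact: integrableR_norm.
    rewrite -[leRHS]mulr1 ler_wpM2l//.
    by have := exp_norm_le_sqrt_sqr mW iW2; rewrite EW2 sqrtr1.
have K3 := stein_m_dependent mdep sz iz4 zeta_out Ez EW2 lh.
rewrite (expectation_std_normal lh ZN).
rewrite (_ : (h \o _) = h \o X1)// expectationE; last exact: integrableR_lip1.
rewrite -EFinB lee_fin.
set Nh := Rintegral (@lebesgue_measure R) _ _ in K3 *; set EW := Rintegral P setT (fun w => h (W w)) in K3.
have K12 := le_trans K1 K1'; rewrite -/EW in K2.
have -> : Rintegral P setT (h \o X1) - Nh =
    (Rintegral P setT (h \o X1) - Rintegral P setT (h \o X2)) +
    (Rintegral P setT (h \o X2) - EW) + (EW - Nh) by ring.
apply: le_trans (ler_normD _ _) _; apply: le_trans (lerD (ler_normD _ _) (lexx _)) _.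
apply: le_trans (lerD (lerD K12 K2) K3) _.
rewrite le_eqVlt; apply/orP; left; apply/eqP; rewrite -/A -/B -/m2 -/m4.
by field; rewrite gt_eqF.
Qed.
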